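(* Let $T,p_1,p_2>0$ and let $c\neq0$ be an arbitrary but fixed real number. Then a travelling wave solution, with the wave speed $c$, of $$u_{tt}+u_{xxxx}+au^+-bu^-=1\ \ (x\in\mathbb{R},\,t>0),\qquad u(x,t)\to 1/a,\ u_x(x,t)\to 0\ \text{ for } |x|\to+\infty,$$ exists for any $(a,b)$ satisfying, for some $x_1\in\left(0,\frac T2\right)$, $$\frac{c^4}{4}<a=\frac{c^4}{4}\cdot R^{p_1,p_2}\left(x_1,\tfrac T2-x_1\right),\qquad 0<b<\frac{c^4}{4}\cdot R^{p_2,p_1}\left(\tfrac T2-x_1,x_1\right).$$
   Context: Here $u^{\pm}=\max\{\pm u,0\}$, so $u=u^+-u^-$. A travelling wave solution with wave speed $c$ is a (classical) solution of the problem $$u_{tt}+u_{xxxx}+au^+-bu^-=1\ \ (x\in\mathbb{R},\,t>0),\qquad u(x,t)\to 1/a,\ u_x(x,t)\to 0\ \text{ for } |x|\to+\infty,$$ of the form $u(x,t)=y(x-ct)$ which is nontrivial, i.e. $y\not\equiv 1/a$; equivalently, $z=y-1/a$ is a nontrivial solution of $z^{(4)}+c^2z''+a(z+1/a)^+-b(z+1/a)^--1=0$ on $\mathbb{R}$ with $z,z'\to0$ as $|s|\to+\infty$. For $p,x>0$ let $$G(p,x):=\frac{(px^2+1)^2\left(\sqrt{p}\,x(px^2+3)+(px^2-3)(px^2+1)\arctan(\sqrt{p}\,x)\right)}{4\sqrt{p^5}\,x^2},$$ $$M(p,x):=\frac{(px^2+1)\left(\sqrt{p}\,x(px^2+3)(3px^2-1)+3(px^2+1)^3\arctan(\sqrt{p}\,x)\right)}{24\sqrt{p^3}\,x^2},$$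 $$N(p,x):=\frac{\sqrt{p}\,x\left(15p^4x^8+70p^3x^6+128p^2x^4+10px^2+65\right)+15(px^2+1)^5\arctan(\sqrt{p}\,x)}{40\sqrt{p}\,x^2(px^2+1)},$$ and let $G_x,M_x,N_x$ denote their first-order partial derivatives with respect to the second variable $x$. For $x_1,x_2>0$ define $$R^{p_1,p_2}(x_1,x_2):=\frac{G_x(p_2,x_2)\left(2M(p_1,x_1)+2M(p_2,x_2)-N(p_1,x_1)-N(p_2,x_2)\right)}{G(p_1,x_1)G_x(p_2,x_2)+G_x(p_1,x_1)G(p_2,x_2)}+\frac{G(p_2,x_2)\left(2M_x(p_1,x_1)-2M_x(p_2,x_2)-N_x(p_1,x_1)+N_x(p_2,x_2)\right)}{G(p_1,x_1)G_x(p_2,x_2)+G_x(p_1,x_1)G(p_2,x_2)}.$$ *)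

(* Defs.v *)
From Stdlib Require Import Reals.
From Coquelicot Require Import Coquelicot.
Open Scope R_scope.

Definition pos_part (u : R) : R := Rmax u 0.
Definition neg_part (u : R) : R := Rmax (- u) 0.

(* u x t, constrained for t > 0 only.  [ex_derive_n f n] concerns only the
   n-th differentiation step, hence the quantification over all lower orders. *)
Definition classical_regularity (u : R -> R -> R) : Prop :=
  forall x t : R, 0 < t ->
    (forall k : nat, (k <= 4)%nat ->
       ex_derive_n (fun x' => u x' t) k x /\
       continuity_2d_pt (fun x0 t0 => Derive_n (fun x' => u x' t0) k x0) x t) /\
    (forall k : nat, (k <= 2)%nat ->
       ex_derive_n (fun t' => u x t') k t /\
       continuity_2d_pt (fun x0 t0 => Derive_n (fun t' => u x0 t') k t0) x t).

Definition beam_equation (a b : R) (u : R -> R -> R) : Prop :=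
  forall x t : R, 0 < t ->
    Derive_n (fun t' => u x t') 2 t + Derive_n (fun x' => u x' t) 4 x
    + a * pos_part (u x t) - b * neg_part (u x t) = 1.

Definition conditions_at_infinity (a : R) (u : R -> R -> R) : Prop :=
  forall t : R, 0 < t ->
    is_lim (fun x => u x t) p_infty (1 / a) /\
    is_lim (fun x => u x t) m_infty (1 / a) /\
    is_lim (fun x => Derive (fun x' => u x' t) x) p_infty 0 /\
    is_lim (fun x => Derive (fun x' => u x' t) x) m_infty 0.

Definition classical_solution (a b : R) (u : R -> R -> R) : Prop :=
  classical_regularity u /\ beam_equation a b u /\ conditions_at_infinity a u.

Definition travelling_wave_solution (a b c : R) (u : R -> R -> R) : Prop :=
  classical_solution a b u /\
  exists y : R -> R,
    (forall x t : R, 0 < t -> u x t = y (x - c * t)) /\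
    (exists s : R, y s <> 1 / a).

Definition Gfun (p x : R) : R :=
  (p * x ^ 2 + 1) ^ 2 *
  (sqrt p * x * (p * x ^ 2 + 3)
   + (p * x ^ 2 - 3) * (p * x ^ 2 + 1) * atan (sqrt p * x))
  / (4 * sqrt (p ^ 5) * x ^ 2).

Definition Mfun (p x : R) : R :=
  (p * x ^ 2 + 1) *
  (sqrt p * x * (p * x ^ 2 + 3) * (3 * p * x ^ 2 - 1)
   + 3 * (p * x ^ 2 + 1) ^ 3 * atan (sqrt p * x))
  / (24 * sqrt (p ^ 3) * x ^ 2).

Definition Nfun (p x : R) : R :=
  (sqrt p * x *
     (15 * p ^ 4 * x ^ 8 + 70 * p ^ 3 * x ^ 6 + 128 * p ^ 2 * x ^ 4
      + 10 * p * x ^ 2 + 65)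
   + 15 * (p * x ^ 2 + 1) ^ 5 * atan (sqrt p * x))
  / (40 * sqrt p * x ^ 2 * (p * x ^ 2 + 1)).

Definition Gx (p x : R) : R := Derive (fun x' => Gfun p x') x.
Definition Mx (p x : R) : R := Derive (fun x' => Mfun p x') x.
Definition Nx (p x : R) : R := Derive (fun x' => Nfun p x') x.

Definition Rfun (p1 p2 x1 x2 : R) : R :=
  Gx p2 x2 * (2 * Mfun p1 x1 + 2 * Mfun p2 x2 - Nfun p1 x1 - Nfun p2 x2)
  / (Gfun p1 x1 * Gx p2 x2 + Gx p1 x1 * Gfun p2 x2)
  + Gfun p2 x2 * (2 * Mx p1 x1 - 2 * Mx p2 x2 - Nx p1 x1 + Nx p2 x2)
    / (Gfun p1 x1 * Gx p2 x2 + Gx p1 x1 * Gfun p2 x2).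

(* Main.v *)
Require Import Defs.
From Stdlib Require Import Reals Lra Lia.
From Coquelicot Require Import Coquelicot.
From mathcomp Require boolp filter.
Open Scope R_scope.

(** Let [K > 0] with [K^2 = c^2 / 2] and write the wave as [u(x,t) = (1 - v(K (x - c t))) / a]. The problem
    becomes [v'''' + 2 v'' + A v = (A - B) (v - 1)^+] with [A = a / K^4 > 1], [B = b / K^4], and
    [v, v' -> 0] at infinity. Since [A > 1] the operator on the left is positive, and it is inverted by
    convolution with an explicit oscillating kernel [green] that decays exponentially. Up to a scaling, a
    solution is therefore a function [w >= 0] with [w = (gam green*w - mu)^+], where [gam = A - B] and [mu > 0].

    This is the Euler-Lagrange equation of the following maximisation, a dual form of a mountain pass:
    maximise [Q(w) = gam <w, green*w> - |w|^2] over all [w >= 0] with [int w <= 1]. The multiplier [mu]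
    of the mass constraint equals the maximum [S], because [Q] is homogeneous of degree two; so a
    solution exists as soon as [S > 0] and the maximum is attained.

    Attainment. Restrict [w] to a window [[-r,r]] by a cutoff. Replacing [w] by
    [(gam green*w - mu)^+], with [mu] adjusted to the mass, does not decrease [Q], because the kernel is
    positive definite ([improve]), and it makes a maximising sequence bounded and equi-Lipschitz, so that a maximiser
    exists ([maximizer_exists]). The window is then removed. By homogeneity mass [m] carries at most
    [S m^2], so a maximiser cannot split into two pieces far apart ([no_gap]); every piece of its
    support carries a fixed amount of mass ([local_mass]); hence its support has a diameter bounded
    independently of [r] ([support_diameter]). A maximiser in a large window can thus be translated to the
    middle, where the cutoff is invisible, and there it solves the equation on the whole line
    ([localized_solution]).

    Positivity of [S]. The half-wave [f(t) = C (1/(1+p t^2) - 1/(1+p x^2))] on [[-x,x]], with [C] such that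
    its end slopes are [1] and [-1], satisfies [int f^2 = G], [int f'^2 = M], [int f''^2 = N]. Positive
    half-waves with parameters [(p2,x2)] and negative ones with [(p1,x1)] fit together to a periodic
    [C^1] function of period [2 (x1 + x2) = T]. The two values of [R] in the hypothesis are the solution [(A, B')] of
    a linear system that contains [A G1 + B' G2 = 2 M1 + 2 M2 - N1 - N2], so that [B < B'] says that the
    form [int psi''^2 - 2 psi'^2 + A (psi^-)^2 + B (psi^+)^2] is negative over one period
    ([R_gives_negative_energy]). Completing a square turns this into [Q(psi^+) > 0]: per period there is a fixed gain,
    while cutting the train of half-waves off costs a bounded amount, so many periods suffice
    ([positive_energy]). *)

(** * Cluster points of equi-Lipschitz sequences *)

(** Limits along an ultrafilter exist for every bounded real sequence at once, which replaces the
    extraction of a diagonal subsequence. *)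
Lemma nonprincipal_ultrafilter : exists U : (nat -> Prop) -> Prop,
  (forall N, U (fun n => (N <= n)%nat)) /\
  (forall A B, U A -> U B -> U (fun n => A n /\ B n)) /\
  (forall A B : nat -> Prop, (forall n, A n -> B n) -> U A -> U B) /\
  (forall A, U A \/ U (fun n => ~ A n)) /\
  (forall A, U A -> exists n, A n).
Proof.
  set (F := fun A : nat -> Prop => exists N : nat, forall n, (N <= n)%nat -> A n).
  assert (PF : @filter.ProperFilter nat F).
  { split.
    - intros [N HN]; exact (HN N (le_n N)).
    - split.
      + exists 0%nat; intros; exact I.
      + intros A B [N HN] [M HM]; exists (N + M)%nat; intros n Hn.
        split; [apply HN | apply HM]; lia.
      + intros A B AB [N HN]; exists N; intros n Hn; apply AB, HN, Hn. }
  destruct (@filter.ultraFilterLemma nat F PF) as [U [HU FU]].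
  assert (PU := @filter.ultra_proper _ _ HU).
  assert (FU' := @filter.filter_filter _ _ PU).
  exists U; split; [|split; [|split; [|split]]].
  - intro N; apply FU; exists N; auto.
  - intros A B; exact (@filter.filterI _ _ FU' A B).
  - intros A B; exact (@filter.filterS _ _ FU' A B).
  - intros A; exact (@filter.in_ultra_setVsetC _ _ A HU).
  - intros A HA; exact (@filter.filter_ex _ _ PU A HA).
Qed.

(** The limit is the supremum of the [t] that lie below the sequence on a set of the ultrafilter. *)
Lemma ultralimit (U : (nat -> Prop) -> Prop) :
  (forall A B, U A -> U B -> U (fun n => A n /\ B n)) ->
  (forall A B : nat -> Prop, (forall n, A n -> B n) -> U A -> U B) ->
  (forall A, U A \/ U (fun n => ~ A n)) ->
  (forall A, U A -> exists n, A n) ->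
  U (fun _ => True) ->
  forall (x : nat -> R) (B : R), (forall n, Rabs (x n) <= B) ->
  {l : R | forall eps, 0 < eps -> U (fun n => Rabs (x n - l) < eps)}.
Proof.
  intros Uand Usub Uor Uex UT x B HB.
  set (E := fun t => U (fun n => t <= x n)).
  assert (Eb : bound E).
  { exists B. intros t Ht. destruct (Uex _ Ht) as [n Hn].
    specialize (HB n). apply Rabs_le_between in HB. lra. }
  assert (Ene : exists t, E t).
  { exists (- B). unfold E. apply (Usub (fun _ => True)); auto.
    intros n _. specialize (HB n). apply Rabs_le_between in HB. lra. }
  destruct (completeness E Eb Ene) as [l [Hub Hlub]]. exists l.
  intros eps He.
  assert (H1 : U (fun n => l - eps < x n)).
  { destruct (Uor (fun n => l - eps < x n)) as [H|H]; auto. exfalso.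
    assert (l <= l - eps); [|lra]. apply Hlub. intros t Ht.
    destruct (Uex _ (Uand _ _ H Ht)) as [n [Hn1 Hn2]]. lra. }
  assert (H2 : U (fun n => x n < l + eps)).
  { destruct (Uor (fun n => x n < l + eps)) as [H|H]; auto. exfalso.
    assert (l + eps <= l); [|lra]. apply Hub.
    apply (Usub (fun n => ~ x n < l + eps)); auto. intros; lra. }
  apply (Usub _ _ (fun n H => proj2 (Rabs_lt_between' (x n) l eps) H)).
  apply (Usub (fun n => l - eps < x n /\ x n < l + eps)); auto.
Qed.

(** The pointwise ultralimit inherits the Lipschitz constant, and on [[-r,r]] the closeness at the points
    of a finite mesh propagates to all points. *)
Lemma arzela_ascoli_cluster (f : nat -> R -> R) (L B : R) : 0 <= L ->
  (forall n x y, Rabs (f n x - f n y) <= L * Rabs (x - y)) ->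
  (forall n x, Rabs (f n x) <= B) ->
  exists g : R -> R,
    (forall x y, Rabs (g x - g y) <= L * Rabs (x - y)) /\
    (forall r eps N, 0 < r -> 0 < eps -> exists n, (N <= n)%nat /\
        forall x, Rabs x <= r -> Rabs (f n x - g x) <= eps).
Proof.
  intros HL Hlip HB.
  destruct nonprincipal_ultrafilter as [U [Utail [Uand [Usub [Uor Uex]]]]].
  assert (UT : U (fun _ => True)) by (apply (Usub (fun n => (0 <= n)%nat)); auto).
  set (g := fun x => proj1_sig (ultralimit U Uand Usub Uor Uex UT (fun n => f n x) B (fun n => HB n x))).
  assert (Hg : forall x eps, 0 < eps -> U (fun n => Rabs (f n x - g x) < eps)).
  { intro x; unfold g; destruct ultralimit as [l Hl]; simpl; auto. }
  clearbody g.
  assert (glip : forall x y, Rabs (g x - g y) <= L * Rabs (x - y)).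
  { intros x y. apply le_epsilon; intros eps He.
    destruct (Uex _ (Uand _ _ (Hg x (eps / 2) ltac:(lra)) (Hg y (eps / 2) ltac:(lra)))) as [n [H1 H2]].
    specialize (Hlip n x y).
    replace (g x - g y) with ((f n x - f n y) + (- (f n x - g x) + (f n y - g y))) by ring.
    eapply Rle_trans; [apply Rabs_triang|]. apply Rplus_le_compat; auto.
    eapply Rle_trans; [apply Rabs_triang|]. rewrite Rabs_Ropp. lra. }
  exists g; split; auto.
  intros r eps N Hr He.
  (* Mesh size: a step of this length changes both functions by at most eps/3. *)
  set (d := eps / (3 * (L + 1))).
  assert (Hd : 0 < d) by (apply Rdiv_lt_0_compat; lra).
  assert (HLd : L * d <= eps / 3).
  { replace (eps / 3) with (L * d + d) by (unfold d; field; lra). lra. }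
  destruct (nfloor_ex (2 * r / d)) as [m [_ Hm]].
  { apply Rdiv_le_0_compat; lra. }
  assert (Hfin : forall k, U (fun n => forall i, (i <= k)%nat ->
     Rabs (f n (- r + INR i * d) - g (- r + INR i * d)) < eps / 3)).
  { induction k as [|k IH].
    - apply (Usub (fun n => Rabs (f n (- r + INR 0 * d) - g (- r + INR 0 * d)) < eps / 3)).
      + intros n H i Hi. replace i with 0%nat by lia. exact H.
      + apply Hg; lra.
    - apply (Usub (fun n => (forall i, (i <= k)%nat ->
         Rabs (f n (- r + INR i * d) - g (- r + INR i * d)) < eps / 3) /\
         Rabs (f n (- r + INR (S k) * d) - g (- r + INR (S k) * d)) < eps / 3)).
      + intros n [H1 H2] i Hi. destruct (Nat.eq_dec i (S k)) as [->|]; auto. apply H1; lia.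
      + apply Uand; auto. apply Hg; lra. }
  destruct (Uex _ (Uand _ _ (Utail N) (Hfin m))) as [n [HN Hn]].
  exists n; split; auto. intros x Hx. apply Rabs_le_between in Hx.
  destruct (nfloor_ex ((x + r) / d)) as [i [Hi1 Hi2]].
  { apply Rdiv_le_0_compat; lra. }
  assert (Hi : (i <= m)%nat).
  { apply Nat.lt_succ_r, INR_lt. rewrite S_INR.
    apply Rle_lt_trans with (2 * r / d); auto.
    apply Rle_trans with ((x + r) / d); auto.
    apply Rmult_le_compat_r; [left; now apply Rinv_0_lt_compat|lra]. }
  specialize (Hn i Hi). set (y := - r + INR i * d) in *.
  assert (Hxy : Rabs (x - y) <= d).
  { assert (E : x + r = (x + r) / d * d) by (field; lra).
    rewrite Rabs_pos_eq; unfold y; nra. }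
  assert (A := Hlip n x y). assert (C := glip y x).
  assert (h := Rabs_pos (x - y)). rewrite (Rabs_minus_sym y x) in C.
  assert (L * Rabs (x - y) <= eps / 3) by nra.
  replace (f n x - g x) with ((f n x - f n y) + ((f n y - g y) + (g y - g x))) by ring.
  eapply Rle_trans; [apply Rabs_triang|].
  eapply Rle_trans; [apply Rplus_le_compat_l, Rabs_triang|]. lra.
Qed.

(** * Continuous functions and their integrals *)

Definition cont (f : R -> R) : Prop := forall x, continuous f x.

Lemma cont_const (c : R) : cont (fun _ => c).
Proof. intro; apply continuous_const. Qed.

Lemma cont_id : cont (fun x => x).
Proof. intro; apply continuous_id. Qed.

Lemma cont_plus f g : cont f -> cont g -> cont (fun x => f x + g x).
Proof. intros Hf Hg x; apply (continuous_plus f g); auto. Qed.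

Lemma cont_minus f g : cont f -> cont g -> cont (fun x => f x - g x).
Proof. intros Hf Hg x; apply (continuous_minus f g); auto. Qed.

Lemma cont_opp f : cont f -> cont (fun x => - f x).
Proof. intros Hf x; apply (continuous_opp f); auto. Qed.

Lemma cont_mult f g : cont f -> cont g -> cont (fun x => f x * g x).
Proof. intros Hf Hg x; apply (continuous_mult f g); auto. Qed.

Lemma cont_comp (h f : R -> R) : cont h -> cont f -> cont (fun x => h (f x)).
Proof. intros Hh Hf x; apply (continuous_comp f h); auto. Qed.

Lemma cont_pow f n : cont f -> cont (fun x => f x ^ n).
Proof.
  intros Hf; induction n as [|n IH]; simpl.
  - apply cont_const.
  - now apply cont_mult.
Qed.

Lemma cont_continuity f : continuity f -> cont f.
Proof. intros H x; apply continuity_pt_filterlim, H. Qed.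

Lemma cont_exp : cont exp.
Proof. apply cont_continuity, derivable_continuous, derivable_exp. Qed.

Lemma cont_sin : cont sin.
Proof. apply cont_continuity, continuity_sin. Qed.

Lemma cont_cos : cont cos.
Proof. apply cont_continuity, continuity_cos. Qed.

Lemma cont_abs : cont Rabs.
Proof. apply cont_continuity, Rcontinuity_abs. Qed.

Lemma cont_max f g : cont f -> cont g -> cont (fun x => Rmax (f x) (g x)).
Proof.
  intros Hf Hg.
  assert (H : cont (fun x => (f x + g x + Rabs (f x - g x)) * / 2)).
  { apply cont_mult; [|apply cont_const].
    apply cont_plus; [now apply cont_plus|].
    apply (cont_comp Rabs (fun x => f x - g x) cont_abs), cont_minus; auto. }
  intro x; apply (continuous_ext (fun x => (f x + g x + Rabs (f x - g x)) * / 2)); [|apply H].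
  intro y; unfold Rmax, Rabs; destruct Rle_dec, Rcase_abs; lra.
Qed.

Lemma cont_min f g : cont f -> cont g -> cont (fun x => Rmin (f x) (g x)).
Proof.
  intros Hf Hg.
  assert (H : cont (fun x => - Rmax (- f x) (- g x))).
  { apply cont_opp, cont_max; apply cont_opp; auto. }
  intro x; apply (continuous_ext (fun x => - Rmax (- f x) (- g x))); [|apply H].
  intro y; unfold Rmax, Rmin; destruct Rle_dec, Rle_dec; lra.
Qed.

Ltac cont_tac :=
  match goal with
  | H : cont ?f |- cont ?f => exact H
  | |- cont (fun x => ?c) => apply (cont_const c)
  | |- cont (fun x => x) => apply cont_id
  | |- cont (fun x => @?f x + @?g x) => apply (cont_plus f g); cont_tac
  | |- cont (fun x => @?f x - @?g x) => apply (cont_minus f g); cont_tac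
  | |- cont (fun x => - @?f x) => apply (cont_opp f); cont_tac
  | |- cont (fun x => @?f x * @?g x) => apply (cont_mult f g); cont_tac
  | |- cont (fun x => @?f x / ?c) => apply (cont_mult f (fun _ => / c)); cont_tac
  | |- cont (fun x => @?f x ^ ?n) => apply (cont_pow f n); cont_tac
  | |- cont (fun x => Rmax (@?f x) (@?g x)) => apply (cont_max f g); cont_tac
  | |- cont (fun x => Rmin (@?f x) (@?g x)) => apply (cont_min f g); cont_tac
  | |- cont (fun x => exp (@?f x)) => apply (cont_comp exp f cont_exp); cont_tac
  | |- cont (fun x => sin (@?f x)) => apply (cont_comp sin f cont_sin); cont_tac
  | |- cont (fun x => cos (@?f x)) => apply (cont_comp cos f cont_cos); cont_tac
  | |- cont (fun x => Rabs (@?f x)) => apply (cont_comp Rabs f cont_abs); cont_tac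
  | H : cont ?h |- cont (fun x => ?h (@?f x)) => apply (cont_comp h f H); cont_tac
  | _ => auto
  end.

(** [RInt] at the type of real functions, so that [ring] and [lra] see equations between reals. *)
Definition integral (f : R -> R) (a b : R) : R := RInt f a b.

Lemma cont_ex_RInt f a b : cont f -> ex_RInt f a b.
Proof. intros H; apply (ex_RInt_continuous (V := R_CompleteNormedModule)); auto. Qed.

Lemma int_plus f g a b : cont f -> cont g ->
  integral (fun x => f x + g x) a b = integral f a b + integral g a b.
Proof. intros; apply (RInt_plus f g); now apply cont_ex_RInt. Qed.

Lemma int_minus f g a b : cont f -> cont g ->
  integral (fun x => f x - g x) a b = integral f a b - integral g a b.
Proof. intros; apply (RInt_minus f g); now apply cont_ex_RInt. Qed.

Lemma int_scal c f a b : cont f ->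
  integral (fun x => c * f x) a b = c * integral f a b.
Proof. intros; apply (RInt_scal f); now apply cont_ex_RInt. Qed.

Lemma int_chasles f a b c : cont f -> integral f a b + integral f b c = integral f a c.
Proof. intros; apply (RInt_Chasles f); now apply cont_ex_RInt. Qed.

Lemma int_le f g a b : a <= b -> cont f -> cont g ->
  (forall x, a <= x <= b -> f x <= g x) -> integral f a b <= integral g a b.
Proof.
  intros ab Hf Hg H; apply RInt_le; auto using cont_ex_RInt.
  intros x Hx; apply H; lra.
Qed.

Lemma int_ge_0 f a b : a <= b -> cont f ->
  (forall x, a <= x <= b -> 0 <= f x) -> 0 <= integral f a b.
Proof.
  intros ab Hf H; apply RInt_ge_0; auto using cont_ex_RInt.
  intros x Hx; apply H; lra.
Qed.

Lemma int_const (c a b : R) : integral (fun _ => c) a b = (b - a) * c.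
Proof. apply (RInt_const a b c). Qed.

Lemma int_abs f a b : a <= b -> cont f ->
  Rabs (integral f a b) <= integral (fun x => Rabs (f x)) a b.
Proof. intros ab Hf; apply abs_RInt_le; auto using cont_ex_RInt. Qed.

Lemma int_ext (f g : R -> R) a b :
  (forall x, Rmin a b < x < Rmax a b -> f x = g x) -> integral f a b = integral g a b.
Proof. apply RInt_ext. Qed.

Lemma int_zero f a b : (forall x, Rmin a b < x < Rmax a b -> f x = 0) ->
  integral f a b = 0.
Proof.
  intros H; rewrite (int_ext f (fun _ => 0)); auto.
  rewrite int_const; ring.
Qed.

(** A positive value would by continuity contribute a positive integral over a small interval. *)
Lemma int_zero_eq f a b : a < b -> cont f -> (forall x, a <= x <= b -> 0 <= f x) ->
  integral f a b <= 0 -> forall x, a < x < b -> f x = 0.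
Proof.
  intros ab Hf Hpos Hint x Hx.
  destruct (Req_dec (f x) 0) as [|Hne]; auto; exfalso.
  assert (H0 : 0 < f x) by (specialize (Hpos x); lra).
  assert (Hd := Hf x).
  destruct (proj1 (filterlim_locally f (f x)) Hd (mkposreal _ H0)) as [d Hd'].
  set (e := Rmin (d / 2) (Rmin (x - a) (b - x))).
  assert (He : 0 < e).
  { unfold e; repeat apply Rmin_glb_lt; try lra. assert (h := cond_pos d); lra. }
  assert (e <= d / 2) by apply Rmin_l.
  assert (e <= Rmin (x - a) (b - x)) by apply Rmin_r.
  assert (Rmin (x - a) (b - x) <= x - a) by apply Rmin_l.
  assert (Rmin (x - a) (b - x) <= b - x) by apply Rmin_r.
  assert (h := cond_pos d).
  assert (0 < integral f (x - e) (x + e)).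
  { apply RInt_gt_0; auto; try lra. intros y Hy.
    specialize (Hd' y). unfold ball in Hd'; simpl in Hd'. unfold AbsRing_ball, abs, minus, plus, opp in Hd'; simpl in Hd'.
    assert (Hy' : Rabs (y + - x) < d) by (apply Rabs_lt_between; lra).
    apply Hd' in Hy'. apply Rabs_lt_between in Hy'. lra. }
  assert (0 <= integral f a (x - e)) by (apply int_ge_0; auto; try lra; intros; apply Hpos; lra).
  assert (0 <= integral f (x + e) b) by (apply int_ge_0; auto; try lra; intros; apply Hpos; lra).
  rewrite <- (int_chasles f a (x - e) b), <- (int_chasles f (x - e) (x + e) b) in Hint; auto.
  lra.
Qed.

Lemma int_opp_var f a b : cont f -> integral (fun y => f (- y)) a b = integral f (- b) (- a).
Proof.
  intros Hf.
  assert (H := RInt_comp_lin f (-1) 0 a b (cont_ex_RInt _ _ _ Hf)).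
  replace (-1 * a + 0) with (- a) in H by ring.
  replace (-1 * b + 0) with (- b) in H by ring.
  assert (E := int_chasles f (- a) (- b) (- a) Hf).
  assert (Z : integral f (- a) (- a) = 0).
  { apply int_zero; intros x Hx; rewrite Rmin_left, Rmax_left in Hx; lra. }
  assert (F : integral (fun y => -1 * f (- y)) a b = integral f (- a) (- b)).
  { etransitivity; [|exact H]. apply int_ext; intros y _.
    unfold scal; simpl; unfold mult; simpl. do 2 f_equal; ring. }
  rewrite int_scal in F by cont_tac. lra.
Qed.

Lemma int_shift f t a b : cont f -> integral (fun y => f (y + t)) a b = integral f (a + t) (b + t).
Proof.
  intros Hf.
  assert (H := RInt_comp_lin f 1 t a b (cont_ex_RInt _ _ _ Hf)).
  rewrite !Rmult_1_l in H; etransitivity; [|exact H].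
  apply int_ext; intros y _; unfold scal; simpl; unfold mult; simpl.
  rewrite !Rmult_1_l; reflexivity.
Qed.

Lemma int_derive (F f : R -> R) a b : (forall x, is_derive F x (f x)) -> cont f ->
  integral f a b = F b - F a.
Proof.
  intros HF Hf; apply is_RInt_unique.
  apply (is_RInt_derive F f); auto.
Qed.

Lemma is_derive_int f a x : cont f -> is_derive (fun z => integral f a z) x (f x).
Proof.
  intros Hf; apply (is_derive_RInt f (fun z => integral f a z) a x); auto.
  apply filter_forall; intro z; exact (RInt_correct f a z (cont_ex_RInt f a z Hf)).
Qed.

Lemma cont_derive f df : (forall x, is_derive f x (df x)) -> cont f.
Proof. intros H x; apply (ex_derive_continuous f); eexists; apply H. Qed.

Lemma cont_lip f L : (forall x y, Rabs (f x - f y) <= L * Rabs (x - y)) -> cont f.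
Proof.
  intros H x. apply (proj2 (filterlim_locally f (f x))). intro eps.
  assert (HL : 0 < Rabs L + 1) by (assert (h := Rabs_pos L); lra).
  assert (Hd : 0 < eps / (Rabs L + 1)) by (apply Rdiv_lt_0_compat; auto; apply cond_pos).
  exists (mkposreal _ Hd). intros y Hy.
  unfold ball in *; simpl in *. unfold AbsRing_ball, abs, minus, plus, opp in *; simpl in *.
  eapply Rle_lt_trans; [apply H|].
  apply Rle_lt_trans with ((Rabs L + 1) * Rabs (y - x)).
  - apply Rmult_le_compat_r; [apply Rabs_pos|]. assert (h := Rle_abs L); lra.
  - replace (pos eps) with ((Rabs L + 1) * (eps / (Rabs L + 1))) by (field; lra).
    apply Rmult_lt_compat_l; auto.
Qed.

Lemma lip_of_derive (f df : R -> R) L : (forall x, is_derive f x (df x)) -> (forall x, Rabs (df x) <= L) ->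
  forall x y, Rabs (f x - f y) <= L * Rabs (x - y).
Proof.
  intros Hd HL x y.
  destruct (MVT_gen f y x df) as [c [_ E]].
  - intros; apply Hd.
  - intros z _. apply continuity_pt_filterlim. apply (cont_derive f df Hd).
  - rewrite E, Rabs_mult. apply Rmult_le_compat_r; [apply Rabs_pos|auto].
Qed.

Lemma Rmax0_lip a b : Rabs (Rmax 0 a - Rmax 0 b) <= Rabs (a - b).
Proof. unfold Rmax; repeat destruct Rle_dec; unfold Rabs; repeat destruct Rcase_abs; lra. Qed.

Lemma int_enlarge f r R' : 0 <= r <= R' -> cont f -> (forall x, r <= Rabs x -> f x = 0) ->
  integral f (- R') R' = integral f (- r) r.
Proof.
  intros Hr Hf H0.
  rewrite <- (int_chasles f (- R') (- r) R'), <- (int_chasles f (- r) r R') by auto.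
  rewrite (int_zero f (- R') (- r)), (int_zero f r R'); try ring.
  - intros x Hx; rewrite Rmin_left, Rmax_right in Hx by lra; apply H0; rewrite Rabs_pos_eq; lra.
  - intros x Hx; rewrite Rmin_left, Rmax_right in Hx by lra; apply H0; rewrite Rabs_left; lra.
Qed.

Lemma int_shift_supp f r t : 0 <= r -> cont f -> (forall x, r <= Rabs x -> f x = 0) ->
  (forall x, r <= Rabs x -> f (x + t) = 0) ->
  integral (fun y => f (y + t)) (- r) r = integral f (- r) r.
Proof.
  intros Hr Hf H0 H1. rewrite int_shift by auto.
  assert (A : integral f (- r) (- r + t) = 0).
  { apply int_zero; intros x Hx. destruct (Rle_dec 0 t).
    - rewrite Rmin_left, Rmax_right in Hx by lra.
      replace x with (x - t + t) by ring; apply H1; rewrite Rabs_left1; lra.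
    - rewrite Rmin_right, Rmax_left in Hx by lra. apply H0; rewrite Rabs_left1; lra. }
  assert (B : integral f r (r + t) = 0).
  { apply int_zero; intros x Hx. destruct (Rle_dec 0 t).
    - rewrite Rmin_left, Rmax_right in Hx by lra. apply H0; rewrite Rabs_pos_eq; lra.
    - rewrite Rmin_right, Rmax_left in Hx by lra.
      replace x with (x - t + t) by ring; apply H1; rewrite Rabs_pos_eq; lra. }
  assert (C := int_chasles f (- r) (- r + t) (r + t) Hf).
  assert (D := int_chasles f (- r) r (r + t) Hf).
  lra.
Qed.

(** [auto_derive] leaves terms [Derive] of eta-expanded functions; they are replaced by the derivative
    that [H] provides. *)
Ltac derive_subst H :=
  match type of H with
  | is_derive ?F ?x ?d =>
    replace (Derive (fun x0 : R => F x0) x) with d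
      by (symmetry; apply is_derive_unique; exact H)
  end.

(** Side equations of derivative lemmas live in the carrier of a normed module, where [ring] and
    [field] do not recognise them. *)
Ltac eq_in_R := match goal with |- @eq _ ?a ?b => change (@eq R a b) end.

(** * The half-wave and the functions G, M, N *)

(** The factor that gives the half-wave end slopes of modulus one, so that consecutive half-waves of
    opposite sign join with a continuous derivative whatever their parameters are. *)
Definition profile_height (p x : R) : R := (1 + p * x ^ 2) ^ 2 / (2 * p * x).
Definition profile (p x t : R) : R := profile_height p x * (/ (1 + p * t ^ 2) - / (1 + p * x ^ 2)).
Definition profile1 (p x t : R) : R := profile_height p x * (- (2 * p * t) / (1 + p * t ^ 2) ^ 2).
Definition profile2 (p x t : R) : R :=
  profile_height p x * (2 * p * (3 * p * t ^ 2 - 1) / (1 + p * t ^ 2) ^ 3).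

Section Profile.
Variables p x : R.
Hypothesis p_pos : 0 < p.
Hypothesis x_pos : 0 < x.

Lemma den_pos t : 0 < 1 + p * t ^ 2.
Proof. assert (h := pow2_ge_0 t). nra. Qed.

Lemma profile_height_pos : 0 < profile_height p x.
Proof. apply Rdiv_lt_0_compat; [apply pow_lt, den_pos|nra]. Qed.

Lemma profile_derive t : is_derive (profile p x) t (profile1 p x t).
Proof.
  assert (h := den_pos t). unfold profile, profile1. auto_derive; [lra|].
  field. assert (h' := den_pos x). lra.
Qed.

Lemma profile1_derive t : is_derive (profile1 p x) t (profile2 p x t).
Proof.
  assert (h := den_pos t). unfold profile1, profile2. auto_derive; [nra|].
  field. lra.
Qed.

Lemma cont_inv_den k : cont (fun t => / (1 + p * t ^ 2) ^ k).
Proof.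
  intro t. apply (ex_derive_continuous (fun t => / (1 + p * t ^ 2) ^ k)).
  auto_derive. apply pow_nonzero. assert (h := den_pos t). lra.
Qed.

Lemma cont_profile : cont (profile p x).
Proof. eapply cont_derive; intro; apply profile_derive. Qed.

Lemma cont_profile1 : cont (profile1 p x).
Proof. eapply cont_derive; intro; apply profile1_derive. Qed.

Lemma cont_profile2 : cont (profile2 p x).
Proof. assert (h := cont_inv_den 3). unfold profile2, Rdiv. cont_tac. Qed.

Lemma profile_right : profile p x x = 0.
Proof. unfold profile; ring. Qed.

Lemma profile_left : profile p x (- x) = 0.
Proof. unfold profile. replace ((- x) ^ 2) with (x ^ 2) by ring. ring. Qed.

Lemma profile1_right : profile1 p x x = - 1.
Proof. unfold profile1, profile_height. field. assert (h := den_pos x). lra. Qed.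

Lemma profile1_left : profile1 p x (- x) = 1.
Proof.
  unfold profile1, profile_height. replace ((- x) ^ 2) with (x ^ 2) by ring.
  field. assert (h := den_pos x). lra.
Qed.

Lemma profile_sign_in t : Rabs t <= x -> 0 <= profile p x t.
Proof.
  intros H. apply Rmult_le_pos; [left; apply profile_height_pos|].
  assert (h := den_pos t).
  assert (/ (1 + p * x ^ 2) <= / (1 + p * t ^ 2)); [|lra].
  apply Rinv_le_contravar; auto. apply Rplus_le_compat_l, Rmult_le_compat_l; [lra|].
  apply pow_maj_Rabs; auto.
Qed.

Lemma profile_sign_out t : x <= Rabs t -> profile p x t <= 0.
Proof.
  intros H. assert (h := den_pos x).
  assert (/ (1 + p * t ^ 2) <= / (1 + p * x ^ 2)).
  { apply Rinv_le_contravar; auto. apply Rplus_le_compat_l, Rmult_le_compat_l; [lra|].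
    rewrite <- (pow2_abs t). apply pow_incr; lra. }
  assert (k := profile_height_pos). unfold profile. nra.
Qed.

Lemma profile_le_height t : profile p x t <= profile_height p x.
Proof.
  assert (k := profile_height_pos). assert (h := den_pos x). assert (h' := den_pos t).
  apply Rinv_0_lt_compat in h.
  assert (/ (1 + p * t ^ 2) <= / 1).
  { apply Rinv_le_contravar; [lra|]. assert (q := pow2_ge_0 t). nra. }
  rewrite Rinv_1 in H. unfold profile. nra.
Qed.

Definition atan_p (t : R) : R := atan (sqrt p * t) / sqrt p.
Lemma atan_p_derive t : is_derive atan_p t (/ (1 + p * t ^ 2)).
Proof.
  assert (hs := sqrt_lt_R0 p p_pos). assert (h := den_pos t).
  unfold atan_p. auto_derive; auto.
  assert (E : p = sqrt p ^ 2) by (simpl; rewrite Rmult_1_r, sqrt_sqrt; lra).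
  set (q := sqrt p) in *. rewrite E in h |- *. eq_in_R.
  field. repeat split; nra.
Qed.

(** A primitive of [1 / (1 + p t^2)^(k+1)], by the usual reduction formula. *)
Fixpoint inv_pow_prim (k : nat) (t : R) : R :=
  match k with
  | O => atan_p t
  | S k => t / (2 * INR (S k) * (1 + p * t ^ 2) ^ S k) + (2 * INR (S k) - 1) / (2 * INR (S k)) * inv_pow_prim k t
  end.
Lemma inv_pow_prim_derive k t : is_derive (inv_pow_prim k) t (/ (1 + p * t ^ 2) ^ S k).
Proof.
  assert (h := den_pos t). induction k as [|k IH].
  - simpl. rewrite Rmult_1_r. apply atan_p_derive.
  - assert (hk : 0 < INR (S k)) by (apply lt_0_INR; lia).
    assert (hp : 0 < (1 + p * t ^ 2) ^ k) by now apply pow_lt.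
    change (inv_pow_prim (S k)) with (fun t => t / (2 * INR (S k) * (1 + p * t ^ 2) ^ S k) + (2 * INR (S k) - 1) / (2 * INR (S k)) * inv_pow_prim k t).
    set (n := INR (S k)) in *.
    auto_derive.
    + repeat split; [|eexists; apply IH].
      assert (0 < (1 + p * t ^ 2) ^ S k) by now apply pow_lt.
      simpl in *. nra.
    + replace (Derive (fun x0 : R => inv_pow_prim k x0) t) with (/ (1 + p * t ^ 2) ^ S k)
        by (symmetry; apply is_derive_unique; exact IH).
      eq_in_R. simpl Nat.pred. fold n.
      change (match k with 0%nat => 1 | S _ => INR k + 1 end) with n.
      change (p * (t * (t * 1))) with (p * t ^ 2).
      set (u := 1 + p * t ^ 2) in *.
      change (u ^ S (S k)) with (u * (u * u ^ k)). change (u ^ S k) with (u * u ^ k).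
      set (uk := u ^ k) in *.
      assert (E : p * (1 * ((1 + 1) * (t * 1))) * t = 2 * (u - 1)) by (unfold u; ring).
      transitivity (/ (2 * n * (u * uk)) - p * (1 * ((1 + 1) * (t * 1))) * t * / (2 * u * (u * uk))
        + (2 * n - 1) / (2 * n) / (u * uk)).
      { field. repeat split; lra. }
      rewrite E. field. repeat split; lra.
Qed.

Lemma inv_pow_prim_odd k t : inv_pow_prim k (- t) = - inv_pow_prim k t.
Proof.
  induction k as [|k IH].
  - simpl. unfold atan_p. replace (sqrt p * - t) with (- (sqrt p * t)) by ring. rewrite atan_opp. unfold Rdiv; ring.
  - cbn [inv_pow_prim]. rewrite IH. replace ((- t) ^ 2) with (t ^ 2) by ring. unfold Rdiv. ring.
Qed.

Lemma sqrt_odd_pow k : sqrt (p ^ (2 * k + 1)) = sqrt p ^ (2 * k + 1).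
Proof.
  assert (hs := sqrt_lt_R0 p p_pos).
  rewrite <- (sqrt_sqrt p) at 1 by lra. rewrite Rpow_mult_distr.
  apply sqrt_square. apply pow_le; lra.
Qed.

(** With [u = 1 + p t^2] and [U = 1 + p x^2], the integrand is a constant multiple of
    [1/u^2 - 2/(U u) + 1/U^2]. *)
Lemma profile_G : integral (fun t => profile p x t ^ 2) (- x) x = Gfun p x.
Proof.
  assert (hx := den_pos x).
  set (F := fun t => profile_height p x ^ 2 *
    (inv_pow_prim 1 t - 2 / (1 + p * x ^ 2) * inv_pow_prim 0 t + t / (1 + p * x ^ 2) ^ 2)).
  rewrite (int_derive F).
  - unfold F. rewrite !inv_pow_prim_odd. simpl inv_pow_prim. unfold Gfun, profile_height, atan_p.
    change (p ^ 5) with (p ^ (2 * 2 + 1)). rewrite sqrt_odd_pow.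
    assert (hs := sqrt_lt_R0 p p_pos).
    assert (Ep : p = sqrt p ^ 2) by (simpl; rewrite Rmult_1_r, sqrt_sqrt; lra).
    set (q := sqrt p) in *. clearbody q. rewrite Ep in hx |- *. simpl (2 * 2 + 1)%nat. field.
    repeat split; nra.
  - intro t. assert (ht := den_pos t). unfold F.
    assert (D0 := inv_pow_prim_derive 0 t). assert (D1 := inv_pow_prim_derive 1 t).
    set (P0 := inv_pow_prim 0) in *. set (P1 := inv_pow_prim 1) in *. clearbody P0 P1.
    auto_derive.
    + repeat split; eexists; eauto.
    + derive_subst D0. derive_subst D1. unfold profile. eq_in_R. field. lra.
  - assert (h := cont_profile). cont_tac.
Qed.

(** Here [p t^2 / u^4 = 1/u^3 - 1/u^4] with [u = 1 + p t^2]. *)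
Lemma profile_M : integral (fun t => profile1 p x t ^ 2) (- x) x = Mfun p x.
Proof.
  assert (hx := den_pos x).
  set (F := fun t => profile_height p x ^ 2 * (4 * p) * (inv_pow_prim 2 t - inv_pow_prim 3 t)).
  rewrite (int_derive F).
  - unfold F. rewrite !inv_pow_prim_odd. simpl inv_pow_prim. unfold Mfun, profile_height, atan_p.
    change (p ^ 3) with (p ^ (2 * 1 + 1)). rewrite sqrt_odd_pow.
    assert (hs := sqrt_lt_R0 p p_pos).
    assert (Ep : p = sqrt p ^ 2) by (simpl; rewrite Rmult_1_r, sqrt_sqrt; lra).
    set (q := sqrt p) in *. clearbody q. rewrite Ep in hx |- *. simpl (2 * 1 + 1)%nat. field.
    repeat split; nra.
  - intro t. assert (ht := den_pos t). unfold F.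
    assert (D0 := inv_pow_prim_derive 2 t). assert (D1 := inv_pow_prim_derive 3 t).
    set (P2 := inv_pow_prim 2) in *. set (P3 := inv_pow_prim 3) in *. clearbody P2 P3.
    auto_derive.
    + repeat split; eexists; eauto.
    + derive_subst D0. derive_subst D1. unfold profile1. eq_in_R. field. lra.
  - assert (h := cont_profile1). cont_tac.
Qed.

(** Here [3 p t^2 - 1 = 3 u - 4] with [u = 1 + p t^2], whence
    [(3 p t^2 - 1)^2 / u^6 = 9/u^4 - 24/u^5 + 16/u^6]. *)
Lemma profile_N : integral (fun t => profile2 p x t ^ 2) (- x) x = Nfun p x.
Proof.
  assert (hx := den_pos x).
  set (F := fun t => profile_height p x ^ 2 * (4 * p ^ 2) * (9 * inv_pow_prim 3 t - 24 * inv_pow_prim 4 t + 16 * inv_pow_prim 5 t)).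
  rewrite (int_derive F).
  - unfold F. rewrite !inv_pow_prim_odd. simpl inv_pow_prim. unfold Nfun, profile_height, atan_p.
    assert (hs := sqrt_lt_R0 p p_pos).
    assert (Ep : p = sqrt p ^ 2) by (simpl; rewrite Rmult_1_r, sqrt_sqrt; lra).
    set (q := sqrt p) in *. clearbody q. rewrite Ep in hx |- *. field.
    repeat split; nra.
  - intro t. assert (ht := den_pos t). unfold F.
    assert (D0 := inv_pow_prim_derive 3 t). assert (D1 := inv_pow_prim_derive 4 t). assert (D2 := inv_pow_prim_derive 5 t).
    set (P3 := inv_pow_prim 3) in *. set (P4 := inv_pow_prim 4) in *. set (P5 := inv_pow_prim 5) in *. clearbody P3 P4 P5.
    auto_derive.
    + repeat split; eexists; eauto.
    + derive_subst D0. derive_subst D1. derive_subst D2. unfold profile2. eq_in_R. field. lra.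
  - assert (h := cont_profile2). cont_tac.
Qed.

Lemma Gfun_pos : 0 < Gfun p x.
Proof.
  assert (c := cont_profile). rewrite <- profile_G. apply Rnot_le_lt. intro N.
  assert (Z := int_zero_eq (fun t => profile p x t ^ 2) (- x) x ltac:(lra) ltac:(cont_tac)
    (fun t _ => pow2_ge_0 _) N 0 ltac:(lra)). cbv beta in Z.
  assert (P : 0 < profile p x 0).
  { apply Rmult_lt_0_compat; [apply profile_height_pos|].
    assert (0 < p * x ^ 2) by (apply Rmult_lt_0_compat; [|apply pow_lt]; auto).
    replace (1 + p * 0 ^ 2) with 1 by ring.
    assert (/ (1 + p * x ^ 2) < / 1); [|lra].
    apply Rinv_lt_contravar; lra. }
  assert (h := pow2_gt_0 (profile p x 0)). lra.
Qed.

(** The left-hand side is the integral of [(f'' + f)^2]: as [f] vanishes at the ends, [int f f'' = - int f'^2].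
    It forces [B < 1 < A] under the hypothesis of the theorem. *)
Lemma profile_form_nonneg : 0 <= Nfun p x - 2 * Mfun p x + Gfun p x.
Proof.
  assert (c := cont_profile). assert (c1 := cont_profile1). assert (c2 := cont_profile2).
  rewrite <- profile_G, <- profile_M, <- profile_N.
  assert (I : integral (fun t => profile1 p x t * profile1 p x t + profile p x t * profile2 p x t) (- x) x = 0).
  { rewrite (int_derive (fun t => profile p x t * profile1 p x t)).
    - rewrite profile_left, profile_right. ring.
    - intro t. assert (D := profile_derive t). assert (D1 := profile1_derive t). auto_derive.
      + repeat split; eexists; eauto.
      + derive_subst D. derive_subst D1. eq_in_R. ring.
    - cont_tac. }
  assert (P : 0 <= integral (fun t => (profile2 p x t + profile p x t) ^ 2) (- x) x).
  { apply int_ge_0; [lra|cont_tac|]. intros; apply pow2_ge_0. }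
  rewrite (int_ext _ (fun t => profile2 p x t ^ 2 + profile p x t ^ 2
     + (2 * (profile1 p x t * profile1 p x t + profile p x t * profile2 p x t) - 2 * profile1 p x t ^ 2))) in P
    by (intros; ring).
  rewrite !int_plus, int_minus, !int_scal in P by cont_tac. lra.
Qed.

End Profile.

(** * The Green function of v'''' + 2 v'' + A v *)

Definition supported (r : R) (w : R -> R) : Prop := forall x, r <= Rabs x -> w x = 0.

Section Kernel.
Variables al be : R.
Hypothesis al_pos : 0 < al.
Hypothesis be_pos : 0 < be.
Hypothesis be_al : be ^ 2 = al ^ 2 + 1.

Definition green_scale : R := / (4 * al * be * (al ^ 2 + be ^ 2)).

Lemma green_scale_pos : 0 < green_scale.
Proof. apply Rinv_0_lt_compat; repeat apply Rmult_lt_0_compat; try lra; nra. Qed.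

Lemma green_scale_eq : 4 * al * be * (al ^ 2 + be ^ 2) * green_scale = 1.
Proof. unfold green_scale; field. repeat split; nra. Qed.

(** The characteristic roots of [l^4 + 2 l^2 + (al^2 + be^2)^2] are [al + i be], [al - i be] and their
    opposites exactly when [be^2 = al^2 + 1]; this parametrises all equations with constant term [A > 1]. *)
Definition green (s : R) : R :=
  green_scale * exp (- al * Rabs s) * (be * cos (be * s) + al * sin (be * Rabs s)).

Lemma cont_green : cont green.
Proof. unfold green; cont_tac. Qed.

Definition green_max : R := green_scale * (al + be).
Lemma green_max_pos : 0 < green_max.
Proof. apply Rmult_lt_0_compat; [apply green_scale_pos | lra]. Qed.

Lemma green_bound s : Rabs (green s) <= green_max * exp (- al * Rabs s).
Proof.
  unfold green, green_max.
  assert (h := green_scale_pos). assert (e := exp_pos (- al * Rabs s)).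
  rewrite !Rabs_mult, (Rabs_pos_eq green_scale), (Rabs_pos_eq (exp _)) by lra.
  assert (Rabs (be * cos (be * s) + al * sin (be * Rabs s)) <= al + be).
  { assert (c := COS_bound (be * s)). assert (d := SIN_bound (be * Rabs s)).
    apply Rabs_le; nra. }
  assert (0 <= green_scale * exp (- al * Rabs s)) by nra. nra.
Qed.

(** The part of the convolution that comes from the left of [x], with the two trigonometric factors
    separated. The part from the right is the same for the reflected source. These four functions of [x]
    satisfy a linear first-order system, so all derivatives of the potential are combinations
    of them. *)
Definition causal_cos (r : R) (w : R -> R) (x : R) : R :=
  integral (fun y => exp (- al * (x - y)) * cos (be * (x - y)) * w y) (- r) x.
Definition causal_sin (r : R) (w : R -> R) (x : R) : R :=
  integral (fun y => exp (- al * (x - y)) * sin (be * (x - y)) * w y) (- r) x.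

(** The addition formulas separate [x] from [y], after which [x] enters the integrals only through their
    upper bound. *)
Lemma causal_cos_sep r w x : cont w -> causal_cos r w x =
  exp (- al * x) * (cos (be * x) * integral (fun y => exp (al * y) * cos (be * y) * w y) (- r) x
   + sin (be * x) * integral (fun y => exp (al * y) * sin (be * y) * w y) (- r) x).
Proof.
  intros Hw. rewrite <- !int_scal, <- int_plus, <- int_scal by cont_tac.
  apply int_ext; intros y _.
  replace (- al * (x - y)) with (- al * x + al * y) by ring.
  replace (be * (x - y)) with (be * x - be * y) by ring.
  rewrite exp_plus, cos_minus; ring.
Qed.

Lemma causal_sin_sep r w x : cont w -> causal_sin r w x =
  exp (- al * x) * (sin (be * x) * integral (fun y => exp (al * y) * cos (be * y) * w y) (- r) x
   - cos (be * x) * integral (fun y => exp (al * y) * sin (be * y) * w y) (- r) x).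
Proof.
  intros Hw. rewrite <- !int_scal, <- int_minus, <- int_scal by cont_tac.
  apply int_ext; intros y _.
  replace (- al * (x - y)) with (- al * x + al * y) by ring.
  replace (be * (x - y)) with (be * x - be * y) by ring.
  rewrite exp_plus, sin_minus; ring.
Qed.

Lemma is_derive_exp_trig (d1 d2 : R) (F G : R -> R) x :
  is_derive F x d1 -> is_derive G x d2 ->
  is_derive (fun z => exp (- al * z) * (cos (be * z) * F z + sin (be * z) * G z)) x
   (- al * (exp (- al * x) * (cos (be * x) * F x + sin (be * x) * G x))
    - be * (exp (- al * x) * (sin (be * x) * F x - cos (be * x) * G x))
    + exp (- al * x) * (cos (be * x) * d1 + sin (be * x) * d2)).
Proof.
  intros HF HG.
  auto_derive.
  - repeat split; eexists; eauto.
  - derive_subst HF; derive_subst HG.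
    ring.
Qed.

Lemma causal_cos_derive r w x : cont w ->
  is_derive (causal_cos r w) x (- al * causal_cos r w x - be * causal_sin r w x + w x).
Proof.
  intros Hw.
  set (F := integral (fun y => exp (al * y) * cos (be * y) * w y) (- r)).
  set (G := integral (fun y => exp (al * y) * sin (be * y) * w y) (- r)).
  assert (HF : is_derive F x (exp (al * x) * cos (be * x) * w x)).
  { apply (is_derive_int (fun y => exp (al * y) * cos (be * y) * w y)); cont_tac. }
  assert (HG : is_derive G x (exp (al * x) * sin (be * x) * w x)).
  { apply (is_derive_int (fun y => exp (al * y) * sin (be * y) * w y)); cont_tac. }
  apply (is_derive_ext (fun z => exp (- al * z) * (cos (be * z) * F z + sin (be * z) * G z))).
  { intro t; symmetry; apply causal_cos_sep; auto. }
  rewrite causal_cos_sep, causal_sin_sep by auto. fold (F x) (G x).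
  evar_last; [apply (is_derive_exp_trig _ _ F G x HF HG)|].
  assert (E : exp (- al * x) * exp (al * x) = 1).
  { rewrite <- exp_plus. replace (- al * x + al * x) with 0 by ring. apply exp_0. }
  assert (T := sin2_cos2 (be * x)); unfold Rsqr in T.
  replace (exp (- al * x) * (cos (be * x) * (exp (al * x) * cos (be * x) * w x) + sin (be * x) * (exp (al * x) * sin (be * x) * w x)))
   with ((exp (- al * x) * exp (al * x)) * (sin (be * x) * sin (be * x) + cos (be * x) * cos (be * x)) * w x) by ring.
  rewrite E, T. change plus with Rplus. ring.
Qed.

Lemma causal_sin_derive r w x : cont w ->
  is_derive (causal_sin r w) x (- al * causal_sin r w x + be * causal_cos r w x).
Proof.
  intros Hw.
  set (F := integral (fun y => exp (al * y) * cos (be * y) * w y) (- r)).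
  set (G := integral (fun y => exp (al * y) * sin (be * y) * w y) (- r)).
  assert (HF : is_derive F x (exp (al * x) * cos (be * x) * w x)).
  { apply (is_derive_int (fun y => exp (al * y) * cos (be * y) * w y)); cont_tac. }
  assert (HG : is_derive G x (exp (al * x) * sin (be * x) * w x)).
  { apply (is_derive_int (fun y => exp (al * y) * sin (be * y) * w y)); cont_tac. }
  apply (is_derive_ext (fun z => exp (- al * z) * (sin (be * z) * F z - cos (be * z) * G z))).
  { intro t; symmetry; apply causal_sin_sep; auto. }
  rewrite causal_cos_sep, causal_sin_sep by auto. fold (F x) (G x).
  auto_derive.
  - repeat split; eexists; eauto.
  - derive_subst HF; derive_subst HG. ring.
Qed.

Lemma exp_le_1 x : x <= 0 -> exp x <= 1.
Proof. intros H; rewrite <- exp_0. destruct H as [H|H]; [left; now apply exp_increasing | subst; lra]. Qed.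

Lemma damped_bound (t : R) (e wy : R) : Rabs t <= 1 -> 0 <= e ->
  Rabs (e * t * wy) <= e * Rabs wy.
Proof.
  intros Ht He. rewrite !Rabs_mult, (Rabs_pos_eq e) by auto.
  apply Rmult_le_compat_r; [apply Rabs_pos|].
  rewrite <- (Rmult_1_r e) at 2. now apply Rmult_le_compat_l.
Qed.

Lemma Rabs_cos_le x : Rabs (cos x) <= 1.
Proof. apply Rabs_le; assert (h := COS_bound x); lra. Qed.

Lemma Rabs_sin_le x : Rabs (sin x) <= 1.
Proof. apply Rabs_le; assert (h := SIN_bound x); lra. Qed.

(** The weight is at most one on the range of integration. *)
Lemma damped_integral_L1 (t : R -> R) r w x : 0 <= r -> cont w -> cont t -> supported r w ->
  (forall y, Rabs (t y) <= 1) ->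
  Rabs (integral (fun y => exp (- al * (x - y)) * t y * w y) (- r) x)
   <= integral (fun y => Rabs (w y)) (- r) r.
Proof.
  intros Hr Hw Ht Hs Hb.
  assert (Hp : 0 <= integral (fun y => Rabs (w y)) (- r) r).
  { apply int_ge_0; [lra|cont_tac|]. intros; apply Rabs_pos. }
  destruct (Rle_dec x (- r)) as [Hx|Hx].
  - rewrite int_zero; [now rewrite Rabs_R0|].
    intros y Hy; rewrite Rmin_right, Rmax_left in Hy by lra.
    rewrite (Hs y); [ring|]. rewrite Rabs_left1; lra.
  - eapply Rle_trans; [apply int_abs; [lra|cont_tac]|].
    eapply Rle_trans; [apply (int_le _ (fun y => Rabs (w y))); [lra|cont_tac|cont_tac|]|].
    + intros y Hy. eapply Rle_trans; [apply damped_bound; [apply Hb| left; apply exp_pos]|].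
      assert (exp (- al * (x - y)) <= 1) by (apply exp_le_1; nra).
      assert (h := Rabs_pos (w y)). nra.
    + rewrite <- (int_chasles _ (- r) x r) by cont_tac.
      destruct (Rle_dec x r).
      * assert (0 <= integral (fun y => Rabs (w y)) x r); [|lra].
        apply int_ge_0; [lra|cont_tac|]. intros; apply Rabs_pos.
      * rewrite (int_zero _ x r); [lra|].
        intros y Hy; rewrite Rmin_right, Rmax_left in Hy by lra.
        rewrite (Hs y), Rabs_R0; [reflexivity|]. rewrite Rabs_pos_eq; lra.
Qed.

(** The weight has integral at most [1 / al], whatever the size of the support. *)
Lemma damped_integral_sup (t : R -> R) r w x B : 0 <= r -> cont w -> cont t -> supported r w ->
  (forall y, Rabs (t y) <= 1) -> (forall y, Rabs (w y) <= B) ->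
  Rabs (integral (fun y => exp (- al * (x - y)) * t y * w y) (- r) x) <= B / al.
Proof.
  intros Hr Hw Ht Hs Hb HB.
  assert (Hp : 0 <= B / al).
  { apply Rdiv_le_0_compat; auto. eapply Rle_trans; [apply Rabs_pos|apply (HB 0)]. }
  destruct (Rle_dec x (- r)) as [Hx|Hx].
  - rewrite int_zero; [now rewrite Rabs_R0|].
    intros y Hy; rewrite Rmin_right, Rmax_left in Hy by lra.
    rewrite (Hs y); [ring|]. rewrite Rabs_left1; lra.
  - eapply Rle_trans; [apply int_abs; [lra|cont_tac]|].
    eapply Rle_trans; [apply (int_le _ (fun y => exp (- al * (x - y)) * B)); [lra|cont_tac|cont_tac|]|].
    + intros y Hy. eapply Rle_trans; [apply damped_bound; [apply Hb| left; apply exp_pos]|].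
      apply Rmult_le_compat_l; [left; apply exp_pos|apply HB].
    + rewrite (int_derive (fun y => exp (- al * (x - y)) * B / al)).
      * replace (- al * (x - x)) with 0 by ring. rewrite exp_0.
        assert (h := exp_pos (- al * (x - - r))). unfold Rdiv in *. nra.
      * intro y. auto_derive; auto. unfold Rminus. eq_in_R. field. lra.
      * cont_tac.
Qed.

Lemma causal_sin_L1 r w x : 0 <= r -> cont w -> supported r w ->
  Rabs (causal_sin r w x) <= integral (fun y => Rabs (w y)) (- r) r.
Proof.
  intros. apply (damped_integral_L1 (fun y => sin (be * (x - y)))); auto.
  - cont_tac. - intros; apply Rabs_sin_le.
Qed.

Lemma causal_cos_sup r w x B : 0 <= r -> cont w -> supported r w ->
  (forall y, Rabs (w y) <= B) -> Rabs (causal_cos r w x) <= B / al.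
Proof.
  intros. apply (damped_integral_sup (fun y => cos (be * (x - y)))); auto.
  - cont_tac. - intros; apply Rabs_cos_le.
Qed.

Lemma causal_sin_sup r w x B : 0 <= r -> cont w -> supported r w ->
  (forall y, Rabs (w y) <= B) -> Rabs (causal_sin r w x) <= B / al.
Proof.
  intros. apply (damped_integral_sup (fun y => sin (be * (x - y)))); auto.
  - cont_tac. - intros; apply Rabs_sin_le.
Qed.

Definition mirror (w : R -> R) (y : R) : R := w (- y).

Lemma cont_mirror w : cont w -> cont (mirror w).
Proof. intros; unfold mirror; cont_tac. Qed.

Lemma supported_mirror r w : supported r w -> supported r (mirror w).
Proof. intros H x Hx; unfold mirror; apply H; now rewrite Rabs_Ropp. Qed.

(** The solution of [v'''' + 2 v'' + (al^2 + be^2)^2 v = w] that decays at infinity, for [w] supported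
    in [[-r,r]]. Its derivatives are given in terms of the causal integrals of [w] and its mirror image. *)
Definition potential (r : R) (w : R -> R) (x : R) : R := integral (fun y => green (x - y) * w y) (- r) r.

Definition potential_d1 r w x : R := green_scale * (al ^ 2 + be ^ 2) *
  (causal_sin r (mirror w) (- x) - causal_sin r w x).
Definition potential_d2 r w x : R := green_scale * (al ^ 2 + be ^ 2) *
  (al * causal_sin r w x - be * causal_cos r w x
   + al * causal_sin r (mirror w) (- x) - be * causal_cos r (mirror w) (- x)).
Definition potential_d3 r w x : R := green_scale * (al ^ 2 + be ^ 2) *
  (causal_sin r w x + 2 * al * be * causal_cos r w x
   - causal_sin r (mirror w) (- x) - 2 * al * be * causal_cos r (mirror w) (- x)).

Lemma potential_causal r w x : 0 <= r -> cont w -> supported r w -> potential r w x =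
  green_scale * (be * causal_cos r w x + al * causal_sin r w x
   + be * causal_cos r (mirror w) (- x) + al * causal_sin r (mirror w) (- x)).
Proof.
  intros Hr Hw Hs.
  assert (Hm := cont_mirror _ Hw).
  assert (Hg := cont_green).
  unfold potential. rewrite <- (int_chasles _ (- r) x r) by cont_tac.
  assert (E1 : integral (fun y => green (x - y) * w y) (- r) x
    = green_scale * (be * causal_cos r w x + al * causal_sin r w x)).
  { unfold causal_cos, causal_sin. rewrite <- !int_scal, <- int_plus, <- int_scal by cont_tac.
    apply int_ext; intros y Hy.
    destruct (Rle_dec x (- r)).
    - rewrite Rmin_right, Rmax_left in Hy by lra.
      rewrite (Hs y); [ring|]. rewrite Rabs_left1; lra.
    - rewrite Rmin_left, Rmax_right in Hy by lra.
      unfold green. rewrite (Rabs_pos_eq (x - y)) by lra. ring. }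
  assert (E2 : integral (fun y => green (x - y) * w y) x r
    = green_scale * (be * causal_cos r (mirror w) (- x) + al * causal_sin r (mirror w) (- x))).
  { unfold causal_cos, causal_sin. rewrite <- !int_scal, <- int_plus, <- int_scal by cont_tac.
    assert (E := int_opp_var (fun y => green (x - y) * w y) (- r) (- x)).
    rewrite !Ropp_involutive in E. rewrite <- E by cont_tac.
    apply int_ext; intros y Hy. unfold mirror.
    destruct (Rle_dec (- x) (- r)).
    - rewrite Rmin_right, Rmax_left in Hy by lra.
      rewrite (Hs (- y)); [ring|]. rewrite Rabs_pos_eq; lra.
    - rewrite Rmin_left, Rmax_right in Hy by lra.
      unfold green. rewrite (Rabs_left1 (x - - y)) by lra.
      replace (- (x - - y)) with (- x - y) by ring.
      replace (be * (x - - y)) with (- (be * (- x - y))) by ring.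
      rewrite cos_neg. ring. }
  lra.
Qed.

Lemma mirror_cos_derive r w x : cont w ->
  is_derive (fun x => causal_cos r (mirror w) (- x)) x
   (al * causal_cos r (mirror w) (- x) + be * causal_sin r (mirror w) (- x) - w x).
Proof.
  intros Hw. assert (H := causal_cos_derive r (mirror w) (- x) (cont_mirror _ Hw)).
  evar_last. { apply (is_derive_comp (causal_cos r (mirror w)) Ropp x _ (-1) H). auto_derive; auto. }
  unfold scal; simpl; unfold mult; simpl. unfold mirror at 3. rewrite Ropp_involutive. ring.
Qed.

Lemma mirror_sin_derive r w x : cont w ->
  is_derive (fun x => causal_sin r (mirror w) (- x)) x
   (al * causal_sin r (mirror w) (- x) - be * causal_cos r (mirror w) (- x)).
Proof.
  intros Hw. assert (H := causal_sin_derive r (mirror w) (- x) (cont_mirror _ Hw)).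
  evar_last. { apply (is_derive_comp (causal_sin r (mirror w)) Ropp x _ (-1) H). auto_derive; auto. }
  unfold scal; simpl; unfold mult; simpl. ring.
Qed.

Lemma is_derive_comb4 (f1 f2 f3 f4 : R -> R) (d1 d2 d3 d4 c c1 c2 c3 c4 x : R) :
  is_derive f1 x d1 -> is_derive f2 x d2 -> is_derive f3 x d3 -> is_derive f4 x d4 ->
  is_derive (fun x => c * (c1 * f1 x + c2 * f2 x + c3 * f3 x + c4 * f4 x)) x
    (c * (c1 * d1 + c2 * d2 + c3 * d3 + c4 * d4)).
Proof.
  intros H1 H2 H3 H4. auto_derive.
  - repeat split; eexists; eauto.
  - derive_subst H1; derive_subst H2; derive_subst H3; derive_subst H4. ring.
Qed.

Ltac derive_potential c c1 c2 c3 c4 r w x Hw :=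
  eapply is_derive_ext;
  [ | evar_last;
    [ apply (is_derive_comb4 _ _ _ _ _ _ _ _ c c1 c2 c3 c4 _
        (causal_cos_derive r w x Hw) (causal_sin_derive r w x Hw)
        (mirror_cos_derive r w x Hw) (mirror_sin_derive r w x Hw)) | ] ].

Lemma potential_derive r w x : 0 <= r -> cont w -> supported r w -> is_derive (potential r w) x (potential_d1 r w x).
Proof.
  intros Hr Hw Hs. derive_potential green_scale be al be al r w x Hw.
  - intro t; rewrite potential_causal; auto.
  - eq_in_R; unfold potential_d1; ring.
Qed.

Lemma potential_d1_derive r w x : cont w -> is_derive (potential_d1 r w) x (potential_d2 r w x).
Proof.
  intros Hw. derive_potential (green_scale * (al ^ 2 + be ^ 2)) 0 (-1) 0 1 r w x Hw.
  - intro t; eq_in_R; unfold potential_d1; ring.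
  - eq_in_R; unfold potential_d2; ring.
Qed.

Lemma potential_d2_derive r w x : cont w -> is_derive (potential_d2 r w) x (potential_d3 r w x).
Proof.
  intros Hw. derive_potential (green_scale * (al ^ 2 + be ^ 2)) (- be) al (- be) al r w x Hw.
  - intro t; eq_in_R; unfold potential_d2; ring.
  - eq_in_R; unfold potential_d3.
    set (p := causal_cos r w x); set (q := causal_sin r w x).
    set (P := causal_cos r (mirror w) (- x)); set (Q := causal_sin r (mirror w) (- x)).
    transitivity (green_scale * (al ^ 2 + be ^ 2) *
      ((be ^ 2 - al ^ 2) * (q - Q) + 2 * al * be * (p - P))); [ring|].
    replace (be ^ 2 - al ^ 2) with 1 by (rewrite be_al; ring). ring.
Qed.

(** The source term enters through the jump of the third derivative of the Green function; the
    factor [green_scale] makes this jump equal to one. *)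
Lemma potential_d3_derive r w x : 0 <= r -> cont w -> supported r w ->
  is_derive (potential_d3 r w) x (w x - 2 * potential_d2 r w x - (al ^ 2 + be ^ 2) ^ 2 * potential r w x).
Proof.
  intros Hr Hw Hs. derive_potential (green_scale * (al ^ 2 + be ^ 2)) (2 * al * be) 1 (- (2 * al * be)) (-1) r w x Hw.
  - intro t; eq_in_R; unfold potential_d3; ring.
  - rewrite potential_causal by auto. eq_in_R; unfold potential_d2.
    set (p := causal_cos r w x); set (q := causal_sin r w x).
    set (P := causal_cos r (mirror w) (- x)); set (Q := causal_sin r (mirror w) (- x)).
    transitivity (4 * al * be * (al ^ 2 + be ^ 2) * green_scale * w x
      + green_scale * (al ^ 2 + be ^ 2) * (- al * (1 + 2 * be ^ 2) * q + be * (1 - 2 * al ^ 2) * p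
         - al * (1 + 2 * be ^ 2) * Q + be * (1 - 2 * al ^ 2) * P)).
    { ring. }
    rewrite green_scale_eq.  rewrite be_al. ring.
Qed.

Lemma cont_potential r w : 0 <= r -> cont w -> supported r w -> cont (potential r w).
Proof. intros; eapply cont_derive; intro; apply potential_derive; auto. Qed.

Lemma cont_potential_d1 r w : cont w -> cont (potential_d1 r w).
Proof. intros; eapply cont_derive; intro; apply potential_d1_derive; auto. Qed.

Lemma cont_potential_d2 r w : cont w -> cont (potential_d2 r w).
Proof. intros; eapply cont_derive; intro; apply potential_d2_derive; auto. Qed.

(** * The quadratic form of the Green function *)

Definition pairing (r : R) (w u : R -> R) : R := integral (fun x => w x * potential r u x) (- r) r.

Lemma causal_cos_start r w : causal_cos r w (- r) = 0.
Proof. apply int_zero; intros x Hx; rewrite Rmin_left, Rmax_left in Hx; lra. Qed.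

Lemma causal_sin_start r w : causal_sin r w (- r) = 0.
Proof. apply int_zero; intros x Hx; rewrite Rmin_left, Rmax_left in Hx; lra. Qed.

(** Integration by parts turns [int w green*u] into the energy form of the two potentials on [[-r,r]] plus
    boundary terms. Beyond the support the potentials are combinations of decaying exponentials only, which
    makes the boundary terms a positive multiple of a scalar product: they are the energy of the tails. Symmetry
    and positivity of the pairing can both be read off. *)
Lemma pairing_energy r w u : 0 <= r -> cont w -> cont u -> supported r w -> supported r u ->
  pairing r w u =
  integral (fun x => (potential_d2 r w x + potential r w x) * (potential_d2 r u x + potential r u x)
     + (2 * al * be) ^ 2 * (potential r w x * potential r u x)) (- r) r
  + 2 * (al ^ 2 + be ^ 2) * al * be ^ 2 * green_scale ^ 2 *
    (causal_cos r w r * causal_cos r u r + causal_sin r w r * causal_sin r u r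
     + causal_cos r (mirror w) r * causal_cos r (mirror u) r
     + causal_sin r (mirror w) r * causal_sin r (mirror u) r).
Proof.
  intros Hr Hw Hu Sw Su.
  assert (cV := cont_potential r w Hr Hw Sw).
  assert (cV2 := cont_potential_d2 r w Hw).
  assert (cU := cont_potential r u Hr Hu Su).
  assert (cU2 := cont_potential_d2 r u Hu).
  assert (D0 := fun x => potential_derive r w x Hr Hw Sw).
  assert (D1 := fun x => potential_d1_derive r w x Hw).
  assert (D2 := fun x => potential_d2_derive r w x Hw).
  assert (D3 := fun x => potential_d3_derive r w x Hr Hw Sw).
  assert (E0 := fun x => potential_derive r u x Hr Hu Su).
  assert (E1 := fun x => potential_d1_derive r u x Hu).
  set (F := fun x => potential r u x * potential_d3 r w x - potential_d1 r u x * potential_d2 r w x + potential r u x * potential_d1 r w x - potential r w x * potential_d1 r u x).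
  assert (HF : forall x, is_derive F x (w x * potential r u x -
     ((potential_d2 r w x + potential r w x) * (potential_d2 r u x + potential r u x) + (2 * al * be) ^ 2 * (potential r w x * potential r u x)))).
  { intro x. specialize (D0 x); specialize (D1 x); specialize (D2 x);
    specialize (D3 x); specialize (E0 x); specialize (E1 x).
    unfold F. auto_derive.
    - repeat split; eexists; eauto.
    - derive_subst D0; derive_subst D1; derive_subst D2; derive_subst D3; derive_subst E0; derive_subst E1.
      eq_in_R. replace ((al ^ 2 + be ^ 2) ^ 2) with ((be ^ 2 - al ^ 2) ^ 2 + (2 * al * be) ^ 2) in * by ring.
      replace (be ^ 2 - al ^ 2) with 1 by (rewrite be_al; ring). ring. }
  apply (int_derive F _ (- r) r) in HF; [|cont_tac].
  rewrite int_minus in HF by cont_tac. fold (pairing r w u) in HF.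
  match goal with |- _ = ?a + ?b => assert (HB : F r - F (- r) = b) end.
  { unfold F. rewrite !potential_causal by auto. unfold potential_d1, potential_d2, potential_d3.
    rewrite !Ropp_involutive, !causal_cos_start, !causal_sin_start.
    set (p := causal_cos r w r); set (q := causal_sin r w r).
    set (p' := causal_cos r u r); set (q' := causal_sin r u r).
    set (P := causal_cos r (mirror w) r); set (Q := causal_sin r (mirror w) r).
    set (P' := causal_cos r (mirror u) r); set (Q' := causal_sin r (mirror u) r).
    set (k := green_scale).
    (* The two sides agree modulo al^2 + 1 - be^2. *)
    match goal with |- _ = ?b => transitivity (b + k ^ 2 * (al ^ 2 + be ^ 2) * (al ^ 2 + 1 - be ^ 2) *
      (be * p * q' + al * q * q' + be * P * Q' + al * Q * Q')); [ring|] end.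
    replace (al ^ 2 + 1 - be ^ 2) with 0 by (rewrite be_al; ring). ring. }
  lra.
Qed.

Lemma pairing_sym r w u : 0 <= r -> cont w -> cont u -> supported r w -> supported r u ->
  pairing r w u = pairing r u w.
Proof.
  intros. rewrite !pairing_energy by auto.
  f_equal; [|ring]. apply int_ext; intros; ring.
Qed.

Lemma pairing_nonneg r w : 0 <= r -> cont w -> supported r w -> 0 <= pairing r w w.
Proof.
  intros Hr Hw Sw. rewrite pairing_energy by auto.
  assert (cV := cont_potential r w Hr Hw Sw).
  assert (cV2 := cont_potential_d2 r w Hw).
  apply Rplus_le_le_0_compat.
  - apply int_ge_0; [lra|cont_tac|]. intros x _.
    apply Rplus_le_le_0_compat; [apply Rle_0_sqr|].
    apply Rmult_le_pos; [apply pow2_ge_0|apply Rle_0_sqr].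
  - apply Rmult_le_pos.
    + assert (0 <= green_scale) by (left; apply green_scale_pos).
      repeat apply Rmult_le_pos; try apply pow2_ge_0; try lra.
      apply Rplus_le_le_0_compat; apply pow2_ge_0.
    + repeat apply Rplus_le_le_0_compat; apply Rle_0_sqr.
Qed.

Lemma supported_lin r a b w u : supported r w -> supported r u ->
  supported r (fun y => a * w y + b * u y).
Proof. intros Hw Hu x Hx; rewrite Hw, Hu by auto; ring. Qed.

Lemma pairing_lin_l r a b w w' u : 0 <= r -> cont w -> cont w' -> cont u -> supported r u ->
  pairing r (fun y => a * w y + b * w' y) u = a * pairing r w u + b * pairing r w' u.
Proof.
  intros Hr Hw Hw' Hu Su.
  assert (cU := cont_potential r u Hr Hu Su).
  unfold pairing. rewrite <- !int_scal, <- int_plus by cont_tac.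
  apply int_ext; intros; ring.
Qed.

Lemma pairing_quad r a b w u : 0 <= r -> cont w -> cont u -> supported r w -> supported r u ->
  pairing r (fun y => a * w y + b * u y) (fun y => a * w y + b * u y)
  = a ^ 2 * pairing r w w + 2 * a * b * pairing r w u + b ^ 2 * pairing r u u.
Proof.
  intros. assert (cont (fun y => a * w y + b * u y)) by cont_tac.
  assert (supported r (fun y => a * w y + b * u y)) by now apply supported_lin.
  rewrite pairing_lin_l by auto.
  rewrite (pairing_sym r w (fun y => a * w y + b * u y)), (pairing_sym r u (fun y => a * w y + b * u y)) by auto.
  rewrite !pairing_lin_l by auto. rewrite (pairing_sym r u w) by auto. ring.
Qed.

Lemma kernel_int_bound s t c w x : s <= t -> cont w ->
  (forall y, s <= y <= t -> Rabs (green (x - y)) * Rabs (w y) <= c * Rabs (w y)) ->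
  Rabs (integral (fun y => green (x - y) * w y) s t) <= c * integral (fun y => Rabs (w y)) s t.
Proof.
  intros st Hw H. assert (Hg := cont_green).
  rewrite <- int_scal by cont_tac.
  eapply Rle_trans; [apply int_abs; [auto|cont_tac]|].
  apply int_le; [auto|cont_tac|cont_tac|].
  intros y Hy; rewrite Rabs_mult; auto.
Qed.

Lemma green_le_max s : Rabs (green s) <= green_max.
Proof.
  eapply Rle_trans; [apply green_bound; auto|].
  rewrite <- (Rmult_1_r green_max) at 2. apply Rmult_le_compat_l.
  - left; apply green_max_pos; auto.
  - apply exp_le_1. assert (h := Rabs_pos s). nra.
Qed.

Lemma green_far s D : 0 <= D <= Rabs s -> Rabs (green s) <= green_max * exp (- al * D).
Proof.
  intros H. eapply Rle_trans; [apply green_bound; auto|].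
  apply Rmult_le_compat_l; [left; apply green_max_pos; auto|].
  destruct (proj2 H) as [Hlt|Heq].
  - left; apply exp_increasing; nra.
  - rewrite Heq; lra.
Qed.

Lemma potential_L1 r w x : 0 <= r -> cont w ->
  Rabs (potential r w x) <= green_max * integral (fun y => Rabs (w y)) (- r) r.
Proof.
  intros Hr Hw; apply kernel_int_bound; [lra|auto|].
  intros y _; apply Rmult_le_compat_r; [apply Rabs_pos|apply green_le_max].
Qed.

Lemma potential_far r w x D : 0 <= r -> cont w -> 0 <= D ->
  (forall y, - r <= y <= r -> w y <> 0 -> D <= Rabs (x - y)) ->
  Rabs (potential r w x) <= green_max * exp (- al * D) * integral (fun y => Rabs (w y)) (- r) r.
Proof.
  intros Hr Hw HD H; apply kernel_int_bound; [lra|auto|].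
  intros y Hy; destruct (Req_dec (w y) 0) as [E|E].
  - rewrite E, Rabs_R0; lra.
  - apply Rmult_le_compat_r; [apply Rabs_pos|]. apply green_far; auto.
Qed.

(** Outside the interval [[s, s + 3 D]] the kernel is evaluated at distance at least [D]. *)
Lemma potential_near r w x s D : 0 <= D -> cont w -> (forall y, 0 <= w y) ->
  - r <= s -> s + 3 * D <= r -> s + D <= x <= s + 2 * D ->
  potential r w x <= green_max * integral w s (s + 3 * D) + green_max * exp (- al * D) * integral w (- r) r.
Proof.
  intros HD Hw Hp Hs1 Hs2 Hx.
  assert (Hg := cont_green).
  assert (EA : forall a b, integral (fun y => Rabs (w y)) a b = integral w a b).
  { intros; apply int_ext; intros; now rewrite Rabs_pos_eq. }
  unfold potential.
  rewrite <- (int_chasles _ (- r) s r), <- (int_chasles _ s (s + 3 * D) r) by cont_tac.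
  rewrite <- (int_chasles w (- r) s r), <- (int_chasles w s (s + 3 * D) r) by auto.
  assert (A := kernel_int_bound (- r) s (green_max * exp (- al * D)) w x).
  assert (B := kernel_int_bound s (s + 3 * D) green_max w x).
  assert (C := kernel_int_bound (s + 3 * D) r (green_max * exp (- al * D)) w x).
  rewrite EA in A, B, C.
  assert (P : 0 <= integral w s (s + 3 * D)) by (apply int_ge_0; auto; lra).
  assert (PC := green_max_pos).
  assert (PE := exp_pos (- al * D)).
  assert (0 <= green_max * exp (- al * D) * integral w s (s + 3 * D)).
  { apply Rmult_le_pos; auto. apply Rmult_le_pos; lra. }
  assert (A' : Rabs (integral (fun y => green (x - y) * w y) (- r) s) <= green_max * exp (- al * D) * integral w (- r) s).
  { apply A; auto. intros y Hy. apply Rmult_le_compat_r; [apply Rabs_pos|]. apply green_far.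
    rewrite Rabs_pos_eq; lra. }
  assert (B' : Rabs (integral (fun y => green (x - y) * w y) s (s + 3 * D)) <= green_max * integral w s (s + 3 * D)).
  { apply B; auto; try lra. intros y Hy. apply Rmult_le_compat_r; [apply Rabs_pos|]. apply green_le_max. }
  assert (C' : Rabs (integral (fun y => green (x - y) * w y) (s + 3 * D) r) <= green_max * exp (- al * D) * integral w (s + 3 * D) r).
  { apply C; auto. intros y Hy. apply Rmult_le_compat_r; [apply Rabs_pos|]. apply green_far.
    rewrite Rabs_left1; lra. }
  apply Rabs_le_between in A', B', C'. lra.
Qed.

Lemma mirror_L1 r w : cont w -> integral (fun y => Rabs (mirror w y)) (- r) r = integral (fun y => Rabs (w y)) (- r) r.
Proof.
  intros Hw. unfold mirror. rewrite (int_opp_var (fun y => Rabs (w y))) by cont_tac.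
  now rewrite Ropp_involutive.
Qed.

Lemma potential_d1_L1 r w x : 0 <= r -> cont w -> supported r w ->
  Rabs (potential_d1 r w x) <= 2 * green_scale * (al ^ 2 + be ^ 2) * integral (fun y => Rabs (w y)) (- r) r.
Proof.
  intros Hr Hw Sw. unfold potential_d1.
  assert (A := causal_sin_L1 r w x Hr Hw Sw).
  assert (B := causal_sin_L1 r (mirror w) (- x) Hr (cont_mirror _ Hw) (supported_mirror _ _ Sw)).
  rewrite mirror_L1 in B by auto.
  assert (PK : 0 < green_scale * (al ^ 2 + be ^ 2)).
  { apply Rmult_lt_0_compat; [now apply green_scale_pos|nra]. }
  rewrite Rabs_mult, (Rabs_pos_eq (green_scale * _)) by lra.
  apply Rabs_le_between in A, B.
  replace (2 * green_scale * (al ^ 2 + be ^ 2) * integral (fun y => Rabs (w y)) (- r) r)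
   with (green_scale * (al ^ 2 + be ^ 2) * (2 * integral (fun y => Rabs (w y)) (- r) r)) by ring.
  apply Rmult_le_compat_l; [lra|]. apply Rabs_le. lra.
Qed.

(** The constant does not depend on [r]; this keeps the boundary terms bounded when more and more
    periods of the test function are used. *)
Lemma potential_sup_bounds B : 0 <= B -> exists K, 0 <= K /\ forall r w x, 0 <= r -> cont w -> supported r w ->
  (forall y, Rabs (w y) <= B) ->
  Rabs (potential r w x) <= K /\ Rabs (potential_d1 r w x) <= K /\ Rabs (potential_d2 r w x) <= K /\ Rabs (potential_d3 r w x) <= K.
Proof.
  intros HB.
  assert (PK := green_scale_pos).
  set (M := B / al). assert (HM : 0 <= M) by (apply Rdiv_le_0_compat; auto).
  set (n := al ^ 2 + be ^ 2). assert (Hn : 0 < n) by (unfold n; nra).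
  set (L := 2 * al + 2 * be + 2 + 4 * al * be).
  assert (HL : 0 < L) by (unfold L; nra).
  assert (key : forall c1 c2 c3 c4 p q P Q, Rabs p <= M -> Rabs q <= M -> Rabs P <= M -> Rabs Q <= M ->
     Rabs c1 + Rabs c2 + Rabs c3 + Rabs c4 <= L -> Rabs (c1 * p + c2 * q + c3 * P + c4 * Q) <= L * M).
  { intros c1 c2 c3 c4 p q P Q Hp Hq HP HQ HL'.
    eapply Rle_trans; [apply Rabs_triang|].
    eapply Rle_trans; [apply Rplus_le_compat_r, Rabs_triang|].
    eapply Rle_trans; [apply Rplus_le_compat_r, Rplus_le_compat_r, Rabs_triang|].
    rewrite !Rabs_mult.
    assert (h1 := Rabs_pos c1); assert (h2 := Rabs_pos c2);
    assert (h3 := Rabs_pos c3); assert (h4 := Rabs_pos c4). nra. }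
  exists (green_scale * L * M + green_scale * n * L * M).
  assert (0 <= green_scale * L * M) by (apply Rmult_le_pos; [apply Rmult_le_pos|]; lra).
  assert (0 <= green_scale * n * L * M)
    by (apply Rmult_le_pos; [apply Rmult_le_pos; [apply Rmult_le_pos|]|]; lra).
  split; [lra|].
  intros r w x Hr Hw Sw HwB.
  assert (HmB : forall y, Rabs (mirror w y) <= B) by (intro; apply HwB).
  assert (A1 := causal_cos_sup r w x B Hr Hw Sw HwB).
  assert (A2 := causal_sin_sup r w x B Hr Hw Sw HwB).
  assert (A3 := causal_cos_sup r (mirror w) (- x) B Hr (cont_mirror _ Hw) (supported_mirror _ _ Sw) HmB).
  assert (A4 := causal_sin_sup r (mirror w) (- x) B Hr (cont_mirror _ Hw) (supported_mirror _ _ Sw) HmB).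
  fold M in A1, A2, A3, A4.
  assert (K2 := fun c1 c2 c3 c4 => key c1 c2 c3 c4 _ _ _ _ A1 A2 A3 A4).
  rewrite potential_causal by auto. unfold potential_d1, potential_d2, potential_d3. fold n.
  set (p := causal_cos r w x) in *; set (q := causal_sin r w x) in *.
  set (P := causal_cos r (mirror w) (- x)) in *; set (Q := causal_sin r (mirror w) (- x)) in *.
  assert (0 < al * be) by nra.
  assert (scale : forall c z, 0 <= c -> Rabs z <= L * M -> Rabs (c * z) <= c * L * M).
  { intros c z Hc Hz. rewrite Rabs_mult, (Rabs_pos_eq c), Rmult_assoc by auto. now apply Rmult_le_compat_l. }
  assert (0 <= green_scale * n) by nra.
  repeat split; (eapply Rle_trans; [apply scale; [try lra|]|lra]).
  - eapply Rle_trans; [|apply (K2 be al be al)]; [right; f_equal; ring|].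
    rewrite !Rabs_pos_eq by lra; unfold L; lra.
  - eapply Rle_trans; [|apply (K2 0 (-1) 0 1)]; [right; f_equal; ring|].
    rewrite !Rabs_R0, Rabs_left, Rabs_pos_eq by lra; unfold L; lra.
  - eapply Rle_trans; [|apply (K2 (- be) al (- be) al)]; [right; f_equal; ring|].
    rewrite !Rabs_left, !Rabs_pos_eq by lra; unfold L; lra.
  - eapply Rle_trans; [|apply (K2 (2 * al * be) 1 (- (2 * al * be)) (-1))]; [right; f_equal; ring|].
    rewrite !Rabs_Ropp, (Rabs_left (-1)), !Rabs_pos_eq by lra; unfold L; lra.
Qed.

Lemma pairing_L1 r w u : 0 <= r -> cont w -> cont u -> supported r u ->
  Rabs (pairing r w u) <=
  green_max * integral (fun y => Rabs (w y)) (- r) r * integral (fun y => Rabs (u y)) (- r) r.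
Proof.
  intros Hr Hw Hu Su. unfold pairing.
  assert (cU := cont_potential r u Hr Hu Su).
  eapply Rle_trans; [apply int_abs; [lra|cont_tac]|].
  replace (green_max * integral (fun y => Rabs (w y)) (- r) r * integral (fun y => Rabs (u y)) (- r) r)
    with ((green_max * integral (fun y => Rabs (u y)) (- r) r) * integral (fun y => Rabs (w y)) (- r) r) by ring.
  rewrite <- int_scal by cont_tac.
  apply int_le; [lra|cont_tac|cont_tac|]. intros x _.
  rewrite Rabs_mult, Rmult_comm. apply Rmult_le_compat_r; [apply Rabs_pos|]. now apply potential_L1.
Qed.

(** * The constrained maximum on a window *)

Section Variational.
Variables gam r : R.
Hypothesis gam_pos : 0 < gam.
Hypothesis r_pos : 0 < r.

(** The cutoff makes every competitor vanish continuously at the ends of the window, which a sharp restriction to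
    [[-r,r]] would not do; this allows a maximiser to be translated. *)
Definition cutoff (x : R) : R := Rmax 0 (Rmin 1 (r - Rabs x)).
Definition cut (f : R -> R) (x : R) : R := cutoff x * f x.
Definition mass (f : R -> R) : R := integral (cut f) (- r) r.
(** The quadratic functional [Q] of [w = cut f] when the cutoff is [0] or [1]. In between, the
    weight in the second integral is the cutoff and not its square, so that the optimality
    condition reads [f = (response f - mu)^+], without a division by the cutoff. *)
Definition energy (f : R -> R) : R :=
  gam * pairing r (cut f) (cut f) - integral (fun x => cutoff x * f x ^ 2) (- r) r.
Definition admissible (f : R -> R) : Prop := cont f /\ (forall x, 0 <= f x) /\ mass f <= 1.

Lemma cont_cutoff : cont cutoff.
Proof. unfold cutoff; cont_tac. Qed.

Lemma cutoff_pos x : 0 <= cutoff x.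
Proof. apply Rmax_l. Qed.

Lemma cutoff_le_1 x : cutoff x <= 1.
Proof. apply Rmax_lub; [lra|apply Rmin_l]. Qed.

Lemma cutoff_out x : r <= Rabs x -> cutoff x = 0.
Proof. intros H; unfold cutoff. rewrite Rmax_left; auto. eapply Rle_trans; [apply Rmin_r|lra]. Qed.

Lemma cutoff_in x : Rabs x <= r - 1 -> cutoff x = 1.
Proof. intros H; unfold cutoff. rewrite Rmin_left, Rmax_right; lra. Qed.

Lemma cutoff_gt_0 x : Rabs x < r -> 0 < cutoff x.
Proof. intros H; eapply Rlt_le_trans; [|apply Rmax_r]. apply Rmin_glb_lt; lra. Qed.

Lemma cont_cut f : cont f -> cont (cut f).
Proof. intros; assert (h := cont_cutoff); unfold cut; cont_tac. Qed.

Lemma supported_cut f : supported r (cut f).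
Proof. intros x Hx; unfold cut; rewrite cutoff_out by auto; ring. Qed.

Lemma cut_pos f x : (forall x, 0 <= f x) -> 0 <= cut f x.
Proof. intros; apply Rmult_le_pos; auto; apply cutoff_pos. Qed.

Lemma cut_lin a b f g : cut (fun x => a * f x + b * g x) = fun x => a * cut f x + b * cut g x.
Proof. apply boolp.funext; intro x; unfold cut; ring. Qed.

Lemma mass_abs f : (forall x, 0 <= f x) -> integral (fun x => Rabs (cut f x)) (- r) r = mass f.
Proof. intros; apply int_ext; intros; apply Rabs_pos_eq, cut_pos; auto. Qed.

Lemma mass_lin a b f g : cont f -> cont g ->
  mass (fun x => a * f x + b * g x) = a * mass f + b * mass g.
Proof.
  intros; unfold mass. assert (h := cont_cut f); assert (h' := cont_cut g).
  rewrite <- !int_scal, <- int_plus by cont_tac. now rewrite cut_lin.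
Qed.

Lemma mass_nonneg f : cont f -> (forall x, 0 <= f x) -> 0 <= mass f.
Proof. intros; apply int_ge_0; [lra|now apply cont_cut|]. intros; now apply cut_pos. Qed.

Lemma energy_quad a b f g : cont f -> cont g ->
  energy (fun x => a * f x + b * g x) = a ^ 2 * energy f
  + 2 * a * b * (gam * pairing r (cut f) (cut g) - integral (fun x => cutoff x * f x * g x) (- r) r)
  + b ^ 2 * energy g.
Proof.
  intros Hf Hg. unfold energy. rewrite cut_lin, pairing_quad;
    try apply supported_cut; try apply cont_cut; auto; try lra.
  assert (E : integral (fun x => cutoff x * (a * f x + b * g x) ^ 2) (- r) r
    = a ^ 2 * integral (fun x => cutoff x * f x ^ 2) (- r) r
     + 2 * a * b * integral (fun x => cutoff x * f x * g x) (- r) r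
     + b ^ 2 * integral (fun x => cutoff x * g x ^ 2) (- r) r).
  { assert (h := cont_cutoff). rewrite <- !int_scal, <- !int_plus by cont_tac.
    apply int_ext; intros; ring. }
  rewrite E. ring.
Qed.

Lemma energy_scal a f : cont f -> energy (fun x => a * f x) = a ^ 2 * energy f.
Proof.
  intros Hf. replace (fun x => a * f x) with (fun x => a * f x + 0 * f x).
  - rewrite energy_quad by auto. ring.
  - apply boolp.funext; intro; ring.
Qed.

Lemma mass_scal a f : cont f -> mass (fun x => a * f x) = a * mass f.
Proof.
  intros Hf. replace (fun x => a * f x) with (fun x => a * f x + 0 * f x).
  - rewrite mass_lin by auto. ring.
  - apply boolp.funext; intro; ring.
Qed.

Lemma square_int_nonneg f : cont f -> 0 <= integral (fun x => cutoff x * f x ^ 2) (- r) r.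
Proof.
  intros; assert (h := cont_cutoff). apply int_ge_0; [lra|cont_tac|].
  intros; apply Rmult_le_pos; [apply cutoff_pos|apply pow2_ge_0].
Qed.

Lemma energy_bound f : cont f -> (forall x, 0 <= f x) -> energy f <= gam * green_max * mass f ^ 2.
Proof.
  intros Hf Hp. unfold energy.
  assert (A := square_int_nonneg f Hf).
  assert (B := pairing_L1 r (cut f) (cut f) ltac:(lra) (cont_cut _ Hf) (cont_cut _ Hf) (supported_cut f)).
  rewrite mass_abs in B by auto. apply Rabs_le_between in B.
  assert (gam * pairing r (cut f) (cut f) <= gam * (green_max * mass f * mass f)).
  { apply Rmult_le_compat_l; lra. }
  replace (gam * green_max * mass f ^ 2) with (gam * (green_max * mass f * mass f)) by ring. lra.
Qed.

(** Homogeneity: competitors of mass [m] reach at most [m^2] times the maximum. *)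
Lemma sup_scaling S f : (forall g, admissible g -> energy g <= S) ->
  cont f -> (forall x, 0 <= f x) -> energy f <= S * mass f ^ 2.
Proof.
  intros HS Hf Hp. destruct (mass_nonneg f Hf Hp) as [Hm|Hm].
  - assert (Hi := Rinv_0_lt_compat _ Hm).
    assert (A : energy (fun x => / mass f * f x) <= S).
    { apply HS. split; [cont_tac|split].
      - intro x; apply Rmult_le_pos; auto; lra.
      - rewrite mass_scal by auto. rewrite Rinv_l; lra. }
    rewrite energy_scal in A by auto.
    apply (Rmult_le_compat_r (mass f ^ 2)) in A; [|apply pow2_ge_0].
    replace (energy f) with ((/ mass f) ^ 2 * energy f * mass f ^ 2) by (field; lra). exact A.
  - eapply Rle_trans; [apply energy_bound; auto|]. rewrite <- Hm. right; ring.
Qed.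

Lemma int_bound_const f c : cont f -> (forall x, - r <= x <= r -> Rabs (f x) <= c) ->
  Rabs (integral f (- r) r) <= 2 * r * c.
Proof.
  intros Hf H. eapply Rle_trans; [apply int_abs; [lra|auto]|].
  eapply Rle_trans; [apply (int_le _ (fun _ => c)); [lra|cont_tac|cont_tac|auto]|].
  rewrite int_const. right; ring.
Qed.

Definition truncate (h : R -> R) (mu x : R) : R := Rmax 0 (h x - mu).
Lemma cont_truncate h mu : cont h -> cont (truncate h mu).
Proof. intros; unfold truncate; cont_tac. Qed.

Lemma truncate_pos h mu x : 0 <= truncate h mu x.
Proof. apply Rmax_l. Qed.

(** Half the derivative of the first term of [energy], as a density with respect to the weight [cutoff]. *)
Definition response (f : R -> R) (x : R) : R := gam * potential r (cut f) x.
Lemma cont_response f : cont f -> cont (response f).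
Proof.
  intros Hf; assert (h := cont_potential r (cut f) ltac:(lra) (cont_cut _ Hf) (supported_cut f)).
  unfold response; cont_tac.
Qed.

Lemma response_bound f x : admissible f -> Rabs (response f x) <= gam * green_max.
Proof.
  intros [Hf [Hp Hm]]. unfold response. rewrite Rabs_mult, (Rabs_pos_eq gam) by lra.
  apply Rmult_le_compat_l; [lra|].
  eapply Rle_trans; [apply potential_L1; [lra|now apply cont_cut]|].
  rewrite mass_abs by auto. assert (h := green_max_pos). nra.
Qed.

(** The mass is continuous in the threshold and vanishes for large thresholds; either threshold
    zero already satisfies the constraint or the intermediate value theorem applies. *)
Lemma multiplier_exists h M : cont h -> (forall x, Rabs (h x) <= M) ->
  exists mu, 0 <= mu /\ mass (truncate h mu) <= 1 /\ (mu = 0 \/ mass (truncate h mu) = 1).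
Proof.
  intros Hh HM.
  destruct (Rle_dec (mass (truncate h 0)) 1) as [H0|H0].
  { exists 0; split; [lra|split; auto]. }
  assert (HM0 : 0 <= M) by (eapply Rle_trans; [apply Rabs_pos|apply (HM 0)]).
  assert (HMz : mass (truncate h M) = 0).
  { apply int_zero; intros x _. unfold cut, truncate. rewrite Rmax_left; [ring|].
    specialize (HM x); apply Rabs_le_between in HM; lra. }
  assert (HF : continuity (fun mu => mass (truncate h mu))).
  { intro mu. apply continuity_pt_filterlim.
    apply (cont_lip (fun mu => mass (truncate h mu)) (2 * r)). intros a b.
    replace (mass (truncate h a) - mass (truncate h b))
      with (integral (fun x => cutoff x * (truncate h a x - truncate h b x)) (- r) r).
    - rewrite Rmult_assoc, <- Rmult_assoc.
      apply int_bound_const.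
      + assert (c := cont_cutoff); assert (d := cont_truncate h a Hh); assert (e := cont_truncate h b Hh); cont_tac.
      + intros x _. rewrite Rabs_mult, (Rabs_pos_eq (cutoff x)) by apply cutoff_pos.
        rewrite <- (Rmult_1_l (Rabs (a - b))).
        apply Rmult_le_compat; [apply cutoff_pos|apply Rabs_pos|apply cutoff_le_1|].
        eapply Rle_trans; [apply Rmax0_lip|]. right.
        replace (h x - a - (h x - b)) with (- (a - b)) by ring. apply Rabs_Ropp.
    - unfold mass. rewrite <- int_minus by (apply cont_cut, cont_truncate; auto).
      apply int_ext; intros; unfold cut; ring. }
  destruct (IVT_gen (fun mu => mass (truncate h mu)) 0 M 1 HF) as [mu [Hmu E]].
  { rewrite HMz, Rmin_right, Rmax_left; lra. }
  rewrite Rmin_left in Hmu by auto.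
  exists mu; split; [apply Hmu|split; [rewrite E; lra|auto]].
Qed.

(** By positivity of the pairing, the form [gam <w,green*w>] lies above its linearisation at [cut f]. The truncated
    response maximises this linearisation minus [|.|^2] under the mass constraint, and by strong
    concavity it wins by the squared distance. *)
Lemma improve f : admissible f -> exists mu, 0 <= mu /\
  (mu = 0 \/ mass (truncate (response f) mu) = 1) /\
  admissible (truncate (response f) mu) /\
  energy f + integral (fun x => cutoff x * (f x - truncate (response f) mu x) ^ 2) (- r) r
    <= energy (truncate (response f) mu).
Proof.
  intros Hadm. assert (Hadm' := Hadm). destruct Hadm' as [Hf [Hp Hm]].
  assert (Hh := cont_response f Hf).
  destruct (multiplier_exists (response f) (gam * green_max) Hh (fun x => response_bound f x Hadm))
    as [mu [Hmu [Hmass Hcase]]].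
  exists mu; split; auto; split; auto.
  set (g := truncate (response f) mu) in *.
  assert (Hg : cont g) by (now apply cont_truncate).
  assert (Hgp : forall x, 0 <= g x) by (intro; apply truncate_pos).
  split; [split; auto|].
  assert (cc := cont_cutoff).
  assert (cf := cont_cut f Hf). assert (cg := cont_cut g Hg).
  assert (sf := supported_cut f). assert (sg := supported_cut g).
  assert (cV := cont_potential r (cut f) ltac:(lra) cf sf).
  assert (P : 0 <= pairing r (cut g) (cut g) - 2 * pairing r (cut g) (cut f) + pairing r (cut f) (cut f)).
  { assert (Q := pairing_nonneg r (fun y => 1 * cut g y + -1 * cut f y) ltac:(lra) ltac:(cont_tac) (supported_lin _ _ _ _ _ sg sf)).
    rewrite pairing_quad in Q by (auto; lra). lra. }
  assert (I : integral (fun x => cutoff x * g x ^ 2) (- r) r - integral (fun x => cutoff x * f x ^ 2) (- r) r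
     + integral (fun x => cutoff x * (f x - g x) ^ 2) (- r) r
     <= 2 * gam * pairing r (cut g) (cut f) - 2 * gam * pairing r (cut f) (cut f) - 2 * mu * (mass g - mass f)).
  { unfold pairing, mass. rewrite <- !int_minus, <- !int_scal, <- !int_minus, <- int_plus by cont_tac.
    apply int_le; [lra|cont_tac|cont_tac|]. intros x _.
    (* Pointwise optimality of the truncation, with the gain of a strongly concave quadratic. *)
    assert (K : g x ^ 2 - f x ^ 2 + (f x - g x) ^ 2 <= 2 * (response f x - mu) * (g x - f x)).
    { specialize (Hp x). unfold g, truncate.
      destruct (Rle_dec 0 (response f x - mu)); [rewrite Rmax_right|rewrite Rmax_left]; nra. }
    apply (Rmult_le_compat_l (cutoff x)) in K; [|apply cutoff_pos].
    unfold cut at 1 3 5 6. unfold response in K. lra. }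
  (* Complementary slackness. *)
  assert (M : 0 <= mu * (mass g - mass f)).
  { destruct Hcase as [E|E]; rewrite E; [lra|]. apply Rmult_le_pos; lra. }
  unfold energy.
  assert (0 <= gam * (pairing r (cut g) (cut g) - 2 * pairing r (cut g) (cut f) + pairing r (cut f) (cut f))).
  { apply Rmult_le_pos; lra. }
  lra.
Qed.

Lemma truncate_response_lip f mu x y : admissible f ->
  Rabs (truncate (response f) mu x - truncate (response f) mu y)
   <= gam * (2 * green_scale * (al ^ 2 + be ^ 2)) * Rabs (x - y).
Proof.
  intros [Hf [Hp Hm]]. eapply Rle_trans; [apply Rmax0_lip|].
  replace (response f x - mu - (response f y - mu)) with (gam * (potential r (cut f) x - potential r (cut f) y)) by (unfold response; ring).
  rewrite Rabs_mult, (Rabs_pos_eq gam), Rmult_assoc by lra.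
  apply Rmult_le_compat_l; [lra|].
  apply (lip_of_derive _ (potential_d1 r (cut f))).
  - intro; apply potential_derive; [lra|now apply cont_cut|apply supported_cut].
  - intro z. eapply Rle_trans; [apply potential_d1_L1; [lra|now apply cont_cut|apply supported_cut]|].
    rewrite mass_abs by auto.
    assert (0 < green_scale * (al ^ 2 + be ^ 2)) by (apply Rmult_lt_0_compat; [apply green_scale_pos|nra]).
    nra.
Qed.

(** The cross terms are linear in [d] and the pairing of [cut d] with itself is nonnegative; so passing to a
    uniform limit loses only an amount of order [eps]. *)
Lemma energy_perturb f d eps : admissible f -> cont d -> 0 <= eps <= 1 ->
  (forall x, - r <= x <= r -> Rabs (d x) <= eps) ->
  energy f - (4 * r * gam * green_max + 2 + 2 * r) * eps <= energy (fun x => 1 * f x + 1 * d x).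
Proof.
  intros [Hf [Hp Hm]] Hd He Hb. rewrite energy_quad by auto.
  assert (cc := cont_cutoff). assert (cf := cont_cut f Hf). assert (cd := cont_cut d Hd).
  assert (hC := green_max_pos).
  assert (A : Rabs (pairing r (cut f) (cut d)) <= green_max * (2 * r * eps)).
  { eapply Rle_trans; [apply pairing_L1; auto; [lra|apply supported_cut]|].
    rewrite mass_abs by auto.
    assert (B : Rabs (integral (fun y => Rabs (cut d y)) (- r) r) <= 2 * r * eps).
    { apply int_bound_const; [cont_tac|]. intros x Hx. rewrite Rabs_Rabsolu. unfold cut.
      rewrite Rabs_mult, (Rabs_pos_eq (cutoff x)) by apply cutoff_pos.
      rewrite <- (Rmult_1_l eps). apply Rmult_le_compat; auto using cutoff_pos, Rabs_pos, cutoff_le_1. }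
    apply Rabs_le_between in B.
    assert (0 <= integral (fun y => Rabs (cut d y)) (- r) r).
    { apply int_ge_0; [lra|cont_tac|]. intros; apply Rabs_pos. }
    assert (h := mass_nonneg f Hf Hp).
    rewrite Rmult_assoc. apply Rmult_le_compat_l; [lra|]. nra. }
  assert (B : Rabs (integral (fun x => cutoff x * f x * d x) (- r) r) <= eps).
  { eapply Rle_trans; [apply int_abs; [lra|cont_tac]|].
    eapply Rle_trans; [apply (int_le _ (fun x => eps * cut f x)); [lra|cont_tac|cont_tac|]|].
    - intros x Hx. fold (cut f x). rewrite Rabs_mult, (Rabs_pos_eq (cut f x)) by now apply cut_pos.
      rewrite Rmult_comm. apply Rmult_le_compat_r; auto. now apply cut_pos.
    - rewrite int_scal by auto. fold (mass f). assert (h := mass_nonneg f Hf Hp). nra. }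
  assert (D : - (2 * r * eps) <= energy d).
  { unfold energy. assert (h := pairing_nonneg r (cut d) ltac:(lra) cd (supported_cut d)).
    assert (E : Rabs (integral (fun x => cutoff x * d x ^ 2) (- r) r) <= 2 * r * eps).
    { apply int_bound_const; [cont_tac|]. intros x Hx.
      rewrite Rabs_mult, (Rabs_pos_eq (cutoff x)) by apply cutoff_pos.
      rewrite <- (Rmult_1_l eps). apply Rmult_le_compat; auto using cutoff_pos, Rabs_pos, cutoff_le_1.
      rewrite <- RPow_abs. specialize (Hb x Hx). assert (p := Rabs_pos (d x)). nra. }
    apply Rabs_le_between in E. nra. }
  apply Rabs_le_between in A, B.
  assert (gam * - (green_max * (2 * r * eps)) <= gam * pairing r (cut f) (cut d)) by (apply Rmult_le_compat_l; lra).
  lra.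
Qed.

(** A maximising sequence is replaced by its improvements, which are bounded and equi-Lipschitz because
    the potential smooths; a uniform cluster point is admissible and reaches the supremum. *)
Lemma maximizer_exists : exists f, admissible f /\ forall g, admissible g -> energy g <= energy f.
Proof.
  set (E := fun e => exists f, admissible f /\ e = energy f).
  assert (hC := green_max_pos).
  assert (a0 : admissible (fun _ => 0)).
  { split; [apply cont_const|split; [intro; lra|]].
    unfold mass. rewrite int_zero; [lra|]. intros; unfold cut; ring. }
  destruct (completeness E) as [S [HS1 HS2]].
  { exists (gam * green_max). intros e [f [[Hf [Hp Hm]] ->]].
    eapply Rle_trans; [apply energy_bound; auto|].
    assert (h := mass_nonneg f Hf Hp). assert (0 < gam * green_max) by nra.
    assert (mass f ^ 2 <= 1) by nra. nra. }
  { exists (energy (fun _ => 0)). exists (fun _ => 0). auto. }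
  assert (Hub : forall g, admissible g -> energy g <= S) by (intros g Hg; apply HS1; exists g; auto).
  assert (Hseq : forall n : nat, exists g, admissible g /\ S - / (INR n + 1) <= energy g /\
     (forall x y, Rabs (g x - g y) <= gam * (2 * green_scale * (al ^ 2 + be ^ 2)) * Rabs (x - y)) /\
     (forall x, Rabs (g x) <= gam * green_max)).
  { intro n. assert (Hn : 0 < / (INR n + 1)) by (apply Rinv_0_lt_compat; assert (h := pos_INR n); lra).
    assert (exists f, admissible f /\ S - / (INR n + 1) < energy f) as [f [Hf Hfe]].
    { destruct (Classical_Prop.classic (exists f, admissible f /\ S - / (INR n + 1) < energy f)) as [|N]; auto.
      exfalso. assert (S <= S - / (INR n + 1)); [|lra].
      apply HS2. intros e [f [Hf ->]]. apply Rnot_lt_le. intro; apply N; exists f; auto. }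
    destruct (improve f Hf) as [mu [Hmu [_ [Hg Hge]]]].
    exists (truncate (response f) mu). split; auto. split; [|split].
    - assert (h := square_int_nonneg (fun x => f x - truncate (response f) mu x)).
      assert (cont (fun x => f x - truncate (response f) mu x)).
      { assert (c := proj1 Hf). assert (c' := proj1 Hg). cont_tac. }
      specialize (h H). lra.
    - intros; now apply truncate_response_lip.
    - intro x. assert (B := response_bound f x Hf). unfold truncate.
      apply Rabs_le_between in B. rewrite Rabs_pos_eq by apply Rmax_l.
      apply Rmax_lub; [|lra]. apply Rmult_le_pos; lra. }
  destruct (boolp.choice Hseq) as [gs Hgs].
  destruct (arzela_ascoli_cluster gs (gam * (2 * green_scale * (al ^ 2 + be ^ 2))) (gam * green_max)) as [g [Hlip Hclose]].
  { assert (h := green_scale_pos). repeat apply Rmult_le_pos; try lra. nra. }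
  { intros n; apply Hgs. }
  { intros n; apply Hgs. }
  assert (Hg : cont g) by (eapply cont_lip; apply Hlip).
  assert (Hgp : forall x, 0 <= g x).
  { intro x. apply le_epsilon; intros eps He.
    destruct (Hclose (Rabs x + 1) eps 0%nat) as [n [_ Hn]]; [assert (h := Rabs_pos x); lra|auto|].
    specialize (Hn x ltac:(lra)). destruct (Hgs n) as [[_ [P _]] _]. specialize (P x).
    apply Rabs_le_between in Hn. lra. }
  assert (cc := cont_cutoff).
  assert (Hgm : mass g <= 1).
  { apply le_epsilon; intros eps He.
    destruct (Hclose r (eps / (2 * r)) 0%nat) as [n [_ Hn]]; [auto|apply Rdiv_lt_0_compat; lra|].
    destruct (Hgs n) as [[C [_ M]] _].
    assert (D : Rabs (integral (fun x => cut (gs n) x - cut g x) (- r) r) <= 2 * r * (eps / (2 * r))).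
    { apply int_bound_const.
      - assert (h := cont_cut _ C); assert (h' := cont_cut _ Hg); cont_tac.
      - intros x Hx. unfold cut. rewrite <- Rmult_minus_distr_l, Rabs_mult, (Rabs_pos_eq (cutoff x)) by apply cutoff_pos.
        rewrite <- (Rmult_1_l (eps / _)).
        apply Rmult_le_compat; auto using cutoff_pos, Rabs_pos, cutoff_le_1.
        apply Hn, Rabs_le; lra. }
    rewrite int_minus in D by (apply cont_cut; auto). fold (mass (gs n)) (mass g) in D.
    replace (2 * r * (eps / (2 * r))) with eps in D by (field; lra).
    apply Rabs_le_between in D. lra. }
  exists g. split; [split; auto|].
  intros f Hf. apply Rle_trans with S; auto. clear f Hf.
  apply le_epsilon; intros eps He.
  set (K := 4 * r * gam * green_max + 2 + 2 * r).
  assert (HK : 0 < K).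
  { unfold K. assert (0 < r * gam * green_max) by (apply Rmult_lt_0_compat; [apply Rmult_lt_0_compat|]; auto). lra. }
  (* Half of eps pays for the distance to the cluster point, half for the gap 1/(n+1) to the supremum. *)
  set (d := Rmin 1 (eps / (2 * K))).
  assert (Hd : 0 < d) by (apply Rmin_glb_lt; [lra|apply Rdiv_lt_0_compat; lra]).
  assert (Hd1 : d <= 1) by apply Rmin_l.
  assert (Hd2 : K * d <= eps / 2).
  { replace (eps / 2) with (K * (eps / (2 * K))) by (field; lra).
    apply Rmult_le_compat_l; [lra|apply Rmin_r]. }
  destruct (archimed_cor1 (eps / 2)) as [N [HN1 HN2]]; [lra|].
  destruct (Hclose r d N) as [n [Hn Hcl]]; auto.
  destruct (Hgs n) as [Ha [Hen _]].
  assert (C := proj1 Ha).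
  assert (Cd : cont (fun x => g x - gs n x)) by cont_tac.
  assert (P := energy_perturb (gs n) (fun x => g x - gs n x) d Ha Cd ltac:(lra)).
  fold K in P. cbv beta in P.
  replace (fun x => 1 * gs n x + 1 * (g x - gs n x)) with g in P by (apply boolp.funext; intro; ring).
  assert (Hinv : / (INR n + 1) <= / INR N).
  { apply Rinv_le_contravar; [now apply lt_0_INR|]. apply le_INR in Hn. lra. }
  assert (energy (gs n) - K * d <= energy g).
  { apply P. intros x Hx. rewrite Rabs_minus_sym. apply Hcl, Rabs_le; lra. }
  lra.
Qed.

(** A maximiser equals its improvement, since otherwise the improvement would have larger energy.
    Integrating the equation against [cut f] gives [energy f = mu * mass f], so [mu > 0]; then the mass constraint is
    active and [mu] is the energy. *)
Lemma maximizer_equation f : admissible f -> (forall g, admissible g -> energy g <= energy f) ->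
  0 < energy f ->
  mass f = 1 /\ forall x, - r < x < r -> f x = Rmax 0 (response f x - energy f).
Proof.
  intros Ha Hmax Hpos.
  destruct (improve f Ha) as [mu [Hmu [Hcase [Hg Hge]]]].
  set (g := truncate (response f) mu) in *.
  assert (Hf := proj1 Ha). assert (Hgc := proj1 Hg).
  assert (cc := cont_cutoff).
  assert (cf := cont_cut f Hf).
  assert (E : forall x, - r < x < r -> f x = g x).
  { intros x Hx.
    assert (Z : cutoff x * (f x - g x) ^ 2 = 0).
    { apply (int_zero_eq (fun x => cutoff x * (f x - g x) ^ 2) (- r) r); auto; [lra|cont_tac| |].
      - intros; apply Rmult_le_pos; [apply cutoff_pos|apply pow2_ge_0].
      - specialize (Hmax g Hg). lra. }
    assert (0 < cutoff x) by (apply cutoff_gt_0, Rabs_lt_between; lra).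
    apply Rmult_integral in Z. destruct Z as [Z|Z]; [lra|].
    simpl in Z. rewrite Rmult_1_r in Z. apply Rsqr_0_uniq in Z. lra. }
  assert (Em : mass g = mass f).
  { apply int_ext; intros x Hx. rewrite Rmin_left, Rmax_right in Hx by lra. unfold cut. now rewrite E. }
  assert (En : energy f = mu * mass f).
  { unfold energy, pairing, mass.
    assert (cV := cont_potential r (cut f) ltac:(lra) cf (supported_cut f)).
    rewrite <- !int_scal, <- int_minus by cont_tac.
    apply int_ext; intros x Hx. rewrite Rmin_left, Rmax_right in Hx by lra.
    unfold cut at 1 3.
    assert (Ex := E x Hx). unfold g, truncate in Ex.
    assert (f x ^ 2 = (response f x - mu) * f x).
    { rewrite Ex. destruct (Rle_dec 0 (response f x - mu)); [rewrite Rmax_right|rewrite Rmax_left]; nra. }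
    replace (cutoff x * f x ^ 2) with (cutoff x * ((response f x - mu) * f x)) by (rewrite H; ring).
    unfold response. ring. }
  destruct Hcase as [H0|H1].
  - rewrite H0 in En. lra.
  - rewrite <- Em, H1, Rmult_1_r in En. split; [lra|].
    intros x Hx. rewrite En. rewrite E at 1 by auto. reflexivity.
Qed.

End Variational.

(** * Concentration of the maximiser and removal of the window *)

(** The choice [D = 1 / (al eta)] works because [exp (1/eta) >= 1/eta]. *)
Lemma exp_small eta : 0 < eta -> exists D, 0 < D /\ exp (- al * D) <= eta.
Proof.
  intros He. assert (Hd : 0 < / (al * eta)) by (apply Rinv_0_lt_compat; nra).
  exists (/ (al * eta)). split; auto.
  replace (- al * / (al * eta)) with (- / eta) by (field; lra).
  rewrite exp_Ropp. rewrite <- (Rinv_inv eta) at 2.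
  apply Rinv_le_contravar; [now apply Rinv_0_lt_compat|].
  assert (h := exp_ineq1_le (/ eta)). lra.
Qed.

Lemma pairing_enlarge r r' w : 0 <= r <= r' -> cont w -> supported r w ->
  pairing r' w w = pairing r w w.
Proof.
  intros Hr Hw Sw. assert (Hg := cont_green).
  assert (EV : forall x, potential r' w x = potential r w x).
  { intro x; apply int_enlarge; auto; [cont_tac|]. intros y Hy; rewrite Sw; auto; ring. }
  unfold pairing. replace (potential r' w) with (potential r w) by (apply boolp.funext; intro; now rewrite EV).
  assert (cV := cont_potential r w (proj1 Hr) Hw Sw).
  apply int_enlarge; auto; [cont_tac|]. intros y Hy; rewrite Sw; auto; ring.
Qed.

Section Localization.
Variables gam r sig D : R.
Hypothesis gam_pos : 0 < gam.
Hypothesis r_pos : 0 < r.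
Hypothesis D_pos : 0 < D.
Hypothesis tail_small : gam * (green_max * exp (- al * D)) <= sig / 2.
Hypothesis sig_pos : 0 < sig.
Variable f : R -> R.
Hypothesis f_adm : admissible r f.
Hypothesis f_max : forall g, admissible r g -> energy gam r g <= energy gam r f.
Hypothesis f_energy : sig <= energy gam r f.
Let w := cut r f.

Lemma support_inside x : 0 < w x -> - r < x < r.
Proof.
  intros H. apply Rabs_lt_between. destruct (Rlt_dec (Rabs x) r) as [|N]; auto.
  unfold w in H. rewrite supported_cut in H; lra.
Qed.

Lemma w_pos x : 0 <= w x.
Proof. apply cut_pos, f_adm. Qed.

Lemma cont_w : cont w.
Proof. apply cont_cut, f_adm. Qed.

Lemma w_mass : integral w (- r) r = 1.
Proof. apply (maximizer_equation gam r gam_pos r_pos f); auto. lra. Qed.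

(** At a point of the support the response exceeds the multiplier, hence exceeds [sig]. Mass at distance
    more than [D] accounts for at most [sig / 2] of it, so the rest comes from nearby mass. *)
Lemma local_mass s x : - r <= s -> s + 3 * D <= r -> s + D <= x <= s + 2 * D -> 0 < w x ->
  sig / (2 * gam * green_max) <= integral w s (s + 3 * D).
Proof.
  intros Hs1 Hs2 Hx Hw.
  assert (Hin := support_inside x Hw).
  destruct (maximizer_equation gam r gam_pos r_pos f f_adm f_max) as [_ Heq]; [lra|].
  specialize (Heq x Hin).
  assert (Hfx : 0 < f x).
  { unfold w, cut in Hw. assert (h := cutoff_pos r x). nra. }
  assert (HV : sig < gam * potential r w x).
  { unfold response in Heq. fold w in Heq. unfold Rmax in Heq. destruct Rle_dec; lra. }
  assert (HN := potential_near r w x s D ltac:(lra) cont_w w_pos Hs1 Hs2 Hx).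
  rewrite w_mass, Rmult_1_r in HN.
  apply (Rmult_le_compat_l gam) in HN; [|lra].
  assert (hC := green_max_pos).
  assert (0 < gam * green_max) by nra.
  apply (Rmult_le_reg_l (gam * green_max)); auto.
  replace (gam * green_max * (sig / (2 * gam * green_max))) with (sig / 2) by (field; lra). lra.
Qed.

(** If the support had a gap of length [D], it would split into parts of masses [m1] and [m2] with
    [m1 + m2 = 1], whose interaction is at most [(sig/2) m1 m2]. Then [S <= S (m1^2 + m2^2) + sig m1 m2], that
    is [2 S m1 m2 <= sig m1 m2], which contradicts [S >= sig]. *)
Lemma no_gap z x0 x1 : (forall x, z <= x <= z + D -> w x = 0) ->
  x0 <= z -> z + D <= x1 -> 0 < w x0 -> 0 < w x1 -> False.
Proof.
  intros Hz Hx0 Hx1 Hw0 Hw1.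
  assert (I0 := support_inside _ Hw0). assert (I1 := support_inside _ Hw1).
  assert (Hf0 : forall x, z <= x <= z + D -> f x = 0).
  { intros x Hx. specialize (Hz x Hx). unfold w, cut in Hz.
    assert (0 < cutoff r x) by (apply cutoff_gt_0, Rabs_lt_between; lra).
    apply Rmult_integral in Hz. destruct Hz; lra. }
  (* Since f vanishes on the gap, freezing it there on one side cuts it into its two parts. *)
  set (f1 := fun x => f (Rmin x z)). set (f2 := fun x => f (Rmax x (z + D))).
  destruct f_adm as [Hf [Hp Hm]].
  assert (c1 : cont f1) by (unfold f1; cont_tac).
  assert (c2 : cont f2) by (unfold f2; cont_tac).
  assert (E1l : forall x, x <= z -> f1 x = f x) by (intros; unfold f1; now rewrite Rmin_left).
  assert (E1r : forall x, z <= x -> f1 x = 0) by (intros; unfold f1; rewrite Rmin_right by auto; apply Hf0; lra).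
  assert (E2r : forall x, z + D <= x -> f2 x = f x) by (intros; unfold f2; now rewrite Rmax_left).
  assert (E2l : forall x, x <= z + D -> f2 x = 0) by (intros; unfold f2; rewrite Rmax_right by auto; apply Hf0; lra).
  assert (Ef : f = fun x => 1 * f1 x + 1 * f2 x).
  { apply boolp.funext; intro x. destruct (Rle_dec x z).
    - rewrite E1l, E2l by lra. ring.
    - destruct (Rle_dec (z + D) x).
      + rewrite E1r, E2r by lra; ring.
      + rewrite E1r, E2l, Hf0 by lra; ring. }
  assert (p1 : forall x, 0 <= f1 x) by (intro; apply Hp).
  assert (p2 : forall x, 0 <= f2 x) by (intro; apply Hp).
  assert (EQ := energy_quad gam r r_pos 1 1 f1 f2 c1 c2). rewrite <- Ef in EQ.
  assert (M := mass_lin r 1 1 f1 f2 c1 c2). rewrite <- Ef in M.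
  assert (M1 := w_mass). change (integral w (- r) r) with (mass r f) in M1. rewrite M1 in M.
  assert (S1 := sup_scaling gam r gam_pos r_pos _ f1 f_max c1 p1).
  assert (S2 := sup_scaling gam r gam_pos r_pos _ f2 f_max c2 p2).
  assert (cc1 := cont_cut r f1 c1). assert (cc2 := cont_cut r f2 c2).
  assert (cV := cont_potential r (cut r f2) ltac:(lra) cc2 (supported_cut r f2)).
  assert (hC := green_max_pos). assert (hE := exp_pos (- al * D)).
  assert (m1 := mass_nonneg r r_pos f1 c1 p1). assert (m2 := mass_nonneg r r_pos f2 c2 p2).
  assert (P : pairing r (cut r f1) (cut r f2) <= green_max * exp (- al * D) * mass r f2 * mass r f1).
  { unfold pairing. unfold mass at 2. rewrite <- int_scal by auto.
    apply int_le; [lra|cont_tac|cont_tac|]. intros x Hx.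
    destruct (Rle_dec x z) as [L|L].
    - rewrite Rmult_comm. apply Rmult_le_compat_r; [now apply cut_pos|].
      eapply Rle_trans; [apply Rle_abs|]. rewrite <- (mass_abs r f2 p2).
      apply potential_far; auto; try lra. intros y Hy Hne.
      destruct (Rle_dec (z + D) y).
      + rewrite Rabs_left1; lra.
      + exfalso; apply Hne. unfold cut. rewrite E2l by lra. ring.
    - unfold cut at 1 3. rewrite E1r by lra. right; ring. }
  assert (Q : 0 <= integral (fun x => cutoff r x * f1 x * f2 x) (- r) r).
  { assert (cc := cont_cutoff r). apply int_ge_0; [lra|cont_tac|].
    intros; repeat apply Rmult_le_pos; auto using cutoff_pos. }
  assert (pos : forall g x, cont g -> (forall x, 0 <= g x) -> 0 < cut r g x -> - r < x < r -> 0 < mass r g).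
  { intros g x Hg Hgp Hgx Hx. apply Rnot_le_lt. intro N.
    assert (Z := int_zero_eq (cut r g) (- r) r ltac:(lra) (cont_cut r g Hg) (fun x _ => cut_pos r g x Hgp) N x Hx). lra. }
  assert (pm1 : 0 < mass r f1).
  { apply (pos f1 x0); auto. unfold cut. rewrite E1l by auto. exact Hw0. }
  assert (pm2 : 0 < mass r f2).
  { apply (pos f2 x1); auto. unfold cut. rewrite E2r by auto. exact Hw1. }
  set (S := energy gam r f) in *. set (a := mass r f1) in *. set (b := mass r f2) in *.
  set (e := green_max * exp (- al * D)) in *.
  apply (Rmult_le_compat_l gam) in P; [|lra].
  assert (0 < a * b) by (apply Rmult_lt_0_compat; auto).
  assert (gam * (e * b * a) <= sig / 2 * (a * b)).
  { replace (gam * (e * b * a)) with (gam * e * (a * b)) by ring. apply Rmult_le_compat_r; lra. }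
  assert (E : S * a ^ 2 + S * b ^ 2 = S - 2 * S * (a * b)).
  { replace b with (1 - a) by lra. ring. }
  assert (sig * (a * b) <= S * (a * b)) by (apply Rmult_le_compat_r; lra).
  assert (0 < sig * (a * b)) by (apply Rmult_lt_0_compat; lra).
  lra.
Qed.

(** Between two points of the support, the middle third of each interval of length [3 D] meets the support, so
    each such interval carries the mass given by [local_mass]. *)
Lemma chain_mass x0 x1 : 0 < w x0 -> 0 < w x1 -> forall j, x0 + 3 * D * INR j <= x1 ->
  INR j * (sig / (2 * gam * green_max)) <= integral w x0 (x0 + 3 * D * INR j).
Proof.
  intros H0 H1. assert (I0 := support_inside _ H0). assert (I1 := support_inside _ H1).
  induction j as [|j IH]; intros Hj.
  - simpl. rewrite int_zero; [lra|]. intros x Hx. rewrite Rmin_left, Rmax_left in Hx; lra.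
  - rewrite S_INR in *. set (s := x0 + 3 * D * INR j) in *.
    replace (x0 + 3 * D * (INR j + 1)) with (s + 3 * D) in * by (unfold s; ring).
    assert (hj := pos_INR j).
    assert (Hs : x0 <= s) by (unfold s; nra).
    rewrite <- (int_chasles w x0 s) by apply cont_w.
    specialize (IH ltac:(lra)).
    assert (exists x, s + D <= x <= s + 2 * D /\ 0 < w x) as [x [Hx Hwx]].
    { destruct (Classical_Prop.classic (exists x, s + D <= x <= s + 2 * D /\ 0 < w x)) as [|N]; auto.
      exfalso. apply (no_gap (s + D) x0 x1); auto; try lra.
      intros x Hx. assert (p := w_pos x). destruct (Req_dec (w x) 0); auto.
      exfalso; apply N; exists x; lra. }
    assert (L := local_mass s x ltac:(lra) ltac:(lra) Hx Hwx). lra.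
Qed.

Lemma support_diameter n x0 x1 : 1 < INR n * (sig / (2 * gam * green_max)) ->
  0 < w x0 -> 0 < w x1 -> x1 < x0 + 3 * D * INR n.
Proof.
  intros Hn H0 H1. assert (I0 := support_inside _ H0). assert (I1 := support_inside _ H1).
  apply Rnot_le_lt. intro N.
  assert (L := chain_mass x0 x1 H0 H1 n N). set (s := x0 + 3 * D * INR n) in *.
  assert (hn := pos_INR n). assert (x0 <= s) by (unfold s; nra).
  assert (M := w_mass).
  rewrite <- (int_chasles w (- r) x0 r), <- (int_chasles w x0 s r) in M by apply cont_w.
  assert (0 <= integral w (- r) x0) by (apply int_ge_0; [lra|apply cont_w|intros; apply w_pos]).
  assert (0 <= integral w s r) by (apply int_ge_0; [lra|apply cont_w|intros; apply w_pos]).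
  lra.
Qed.

(** The maximiser times the cutoff is moved to the middle of the window. There it is its own product with the
    cutoff, and its energy has not decreased because the square of the cutoff is at most the cutoff; so it
    is again a maximiser and satisfies the equation inside the window. Outside, it vanishes and its potential is too
    small to exceed the multiplier. *)
Lemma solution_from_maximizer H : 0 < H -> H + D <= r -> H + 1 <= r ->
  (forall x0 x1, 0 < w x0 -> 0 < w x1 -> x1 < x0 + H) ->
  exists mu u, 0 < mu /\ cont u /\ supported r u /\ (exists x, 0 < u x) /\
    forall x, u x = Rmax 0 (gam * potential r u x - mu).
Proof.
  intros HH HD H1 Hdiam.
  assert (exists x0, 0 < w x0) as [t Ht].
  { destruct (Classical_Prop.classic (exists x, 0 < w x)) as [|N]; auto. exfalso.
    assert (M := w_mass). rewrite int_zero in M; [lra|]. intros x _.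
    assert (p := w_pos x). destruct (Req_dec (w x) 0); auto. exfalso; apply N; exists x; lra. }
  set (u := fun x => w (x + t)).
  assert (cw := cont_w).
  assert (cu : cont u) by (unfold u; cont_tac).
  assert (pu : forall x, 0 <= u x) by (intro; apply w_pos).
  assert (su : supported H u).
  { intros x Hx. assert (p := pu x). destruct (Req_dec (u x) 0) as [|N]; auto. exfalso.
    assert (P : 0 < w (x + t)) by (unfold u in *; lra).
    assert (A := Hdiam _ _ Ht P). assert (B := Hdiam _ _ P Ht).
    unfold Rabs in Hx; destruct Rcase_abs; lra. }
  assert (sur : supported r u) by (intros x Hx; apply su; lra).
  assert (sw : supported r w) by apply supported_cut.
  assert (cuteq : cut r u = u).
  { apply boolp.funext; intro x. unfold cut. destruct (Rle_dec H (Rabs x)).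
    - rewrite su by auto; ring.
    - rewrite cutoff_in by lra. ring. }
  assert (Hg := cont_green).
  assert (EV : forall x, potential r u x = potential r w (x + t)).
  { intro x. unfold potential.
    rewrite <- (int_shift_supp (fun y => green (x + t - y) * w y) r t); [|lra|cont_tac| |].
    - apply int_ext; intros y _. replace (x + t - (y + t)) with (x - y) by ring. reflexivity.
    - intros y Hy; rewrite sw by auto; ring.
    - intros y Hy. fold (u y). rewrite sur by auto; ring. }
  assert (cV := cont_potential r w ltac:(lra) cw sw).
  assert (Epair : pairing r u u = pairing r w w).
  { unfold pairing. rewrite <- (int_shift_supp (fun x => w x * potential r w x) r t); [|lra|cont_tac| |].
    - apply int_ext; intros y _. now rewrite EV.
    - intros y Hy; rewrite sw by auto; ring.
    - intros y Hy. fold (u y). rewrite sur by auto; ring. }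
  assert (Emass : integral u (- r) r = 1).
  { unfold u. rewrite int_shift_supp; auto; [apply w_mass|lra]. }
  assert (Eadm : admissible r u).
  { split; auto; split; auto. unfold mass. rewrite cuteq. lra. }
  assert (cf := proj1 f_adm). assert (cc := cont_cutoff r).
  assert (Esq : integral (fun x => cutoff r x * u x ^ 2) (- r) r <= integral (fun x => cutoff r x * f x ^ 2) (- r) r).
  { assert (E : integral (fun x => cutoff r x * u x ^ 2) (- r) r = integral (fun x => w x ^ 2) (- r) r).
    { rewrite <- (int_shift_supp (fun x => w x ^ 2) r t); [|lra|cont_tac| |].
      - apply int_ext; intros y _. change (cutoff r y * u y ^ 2) with (cutoff r y * (u y * (u y * 1))).
        rewrite <- Rmult_assoc. change (cutoff r y * u y) with (cut r u y). rewrite cuteq. reflexivity.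
      - intros y Hy; rewrite sw by auto; ring.
      - intros y Hy. fold (u y). rewrite sur by auto; ring. }
    rewrite E. apply int_le; [lra|cont_tac|cont_tac|]. intros x _. unfold w, cut.
    assert (a := cutoff_pos r x). assert (b := cutoff_le_1 r x). assert (c := pow2_ge_0 (f x)).
    replace ((cutoff r x * f x) ^ 2) with (cutoff r x * (cutoff r x * f x ^ 2)) by ring.
    rewrite <- (Rmult_1_l (cutoff r x * f x ^ 2)) at 2.
    apply Rmult_le_compat_r; auto. now apply Rmult_le_pos. }
  assert (Een : energy gam r f <= energy gam r u).
  { unfold energy. rewrite cuteq, Epair. fold w. lra. }
  destruct (maximizer_equation gam r gam_pos r_pos u Eadm) as [_ Heq].
  { intros g Hadm. eapply Rle_trans; [apply f_max; auto|auto]. }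
  { lra. }
  unfold response in Heq. rewrite cuteq in Heq.
  exists (energy gam r u), u. split; [lra|split; auto; split; auto; split].
  - exists 0. unfold u. now rewrite Rplus_0_l.
  - intro x. destruct (Rlt_dec (Rabs x) r) as [L|L].
    + apply Heq. now apply Rabs_lt_between.
    + rewrite sur by lra.
      assert (F := potential_far r u x D ltac:(lra) cu ltac:(lra)).
      rewrite (int_ext (fun y => Rabs (u y)) u) in F by (intros; now apply Rabs_pos_eq).
      rewrite Emass in F. rewrite Rmax_left; auto.
      assert (G : Rabs (potential r u x) <= green_max * exp (- al * D) * 1).
      { apply F. intros y _ Hne.
        assert (Rabs y < H) by (apply Rnot_le_lt; intro; apply Hne; now apply su).
        assert (T := Rabs_triang (x - y) y). replace (x - y + y) with x in T by ring. lra. }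
      apply Rabs_le_between in G.
      assert (gam * potential r u x <= gam * (green_max * exp (- al * D))) by (apply Rmult_le_compat_l; lra). lra.
Qed.

End Localization.

(** A single competitor of positive energy bounds the maximum from below by [sig] in all large windows. The
    lengths [D] and [H] do not depend on the window, which can therefore be chosen larger than both. *)
Lemma localized_solution gam r0 w0 : 0 < gam -> 0 < r0 -> cont w0 -> (forall x, 0 <= w0 x) ->
  supported r0 w0 ->
  0 < gam * pairing r0 w0 w0 - integral (fun x => w0 x ^ 2) (- r0) r0 ->
  exists r mu u, 0 < r /\ 0 < mu /\ cont u /\ supported r u /\ (exists x, 0 < u x) /\
    forall x, u x = Rmax 0 (gam * potential r u x - mu).
Proof.
  intros Hgam Hr0 cw pw sw Hen.
  set (E0 := gam * pairing r0 w0 w0 - integral (fun x => w0 x ^ 2) (- r0) r0) in *.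
  set (m0 := integral w0 (- r0) r0).
  (* Adding one to the squared mass avoids a division by a possibly zero mass. *)
  set (sig := E0 / (m0 ^ 2 + 1)).
  assert (hm : 0 < m0 ^ 2 + 1) by (assert (h := pow2_ge_0 m0); lra).
  assert (sig_pos : 0 < sig) by (now apply Rdiv_lt_0_compat).
  assert (hC := green_max_pos).
  assert (hgC : 0 < gam * green_max) by nra.
  assert (heta : 0 < sig / (2 * gam * green_max)) by (apply Rdiv_lt_0_compat; lra).
  destruct (exp_small _ heta) as [D [D_pos HD]].
  assert (tail : gam * (green_max * exp (- al * D)) <= sig / 2).
  { replace (sig / 2) with (gam * green_max * (sig / (2 * gam * green_max))) by (field; lra).
    rewrite <- Rmult_assoc. apply Rmult_le_compat_l; lra. }
  destruct (archimed_cor1 (sig / (2 * gam * green_max)) heta) as [n [Hn1 Hn2]].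
  (* More than n separate portions of mass would exceed the total mass one. *)
  assert (Hn : 1 < INR n * (sig / (2 * gam * green_max))).
  { apply lt_0_INR in Hn2. apply (Rmult_lt_compat_l (INR n)) in Hn1; auto. rewrite Rinv_r in Hn1; lra. }
  set (H := 3 * D * INR n).
  assert (HH : 0 < H) by (apply lt_0_INR in Hn2; unfold H; apply Rmult_lt_0_compat; lra).
  set (r := r0 + 1 + H + D).
  assert (Hr : 0 < r) by (unfold r; lra).
  destruct (maximizer_exists gam r Hgam Hr) as [f [Hf Hmax]].
  assert (Ecut : cut r w0 = w0).
  { apply boolp.funext; intro x. unfold cut. destruct (Rle_dec r0 (Rabs x)).
    - rewrite sw by auto; ring.
    - rewrite cutoff_in by (unfold r; lra). ring. }
  assert (Emass : mass r w0 = m0).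
  { unfold mass. rewrite Ecut. apply int_enlarge; auto. unfold r; lra. }
  assert (Een : energy gam r w0 = E0).
  { unfold energy, E0. rewrite Ecut. rewrite (pairing_enlarge r0 r) by (auto; unfold r; lra).
    rewrite (int_ext (fun x => cutoff r x * w0 x ^ 2) (fun x => w0 x ^ 2)).
    - rewrite (int_enlarge (fun x => w0 x ^ 2) r0 r); [reflexivity|unfold r; lra|cont_tac|].
      intros x Hx; rewrite sw by auto; ring.
    - intros x _. change (cutoff r x * w0 x ^ 2) with (cutoff r x * (w0 x * (w0 x * 1))).
      rewrite <- Rmult_assoc. change (cutoff r x * w0 x) with (cut r w0 x). rewrite Ecut. reflexivity. }
  assert (S := sup_scaling gam r Hgam Hr _ w0 Hmax cw pw). rewrite Emass, Een in S.
  assert (Hsig : sig <= energy gam r f).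
  { apply (Rmult_le_reg_r (m0 ^ 2 + 1)); auto.
    replace (sig * (m0 ^ 2 + 1)) with E0 by (unfold sig; field; lra).
    assert (0 <= energy gam r f); [|lra].
    destruct (Rle_dec 0 (energy gam r f)); auto. exfalso.
    assert (h := pow2_ge_0 m0). nra. }
  exists r.
  destruct (solution_from_maximizer gam r sig D Hgam Hr D_pos tail sig_pos f Hf Hmax Hsig H) as [mu [u Hu]]; auto;
    try (unfold r; lra).
  - intros x0 x1 h0 h1. apply (support_diameter gam r sig D Hgam Hr D_pos tail sig_pos f Hf Hmax Hsig n); auto.
  - exists mu, u. tauto.
Qed.

(** * A function of positive energy *)

Section TestFunction.

(** With [phi = psi - potential], this collects the boundary terms of all integrations by parts in the
    expansion of [int (phi'' + phi)^2 + (2 al be)^2 phi^2]. *)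
Definition boundary_term (r : R) (u psi psi1 : R -> R) (t : R) : R :=
  2 * (psi t - potential r u t) * (psi1 t - potential_d1 r u t)
  - 2 * (psi1 t * potential_d2 r u t - psi t * potential_d3 r u t - 2 * psi t * potential_d1 r u t)
  + potential_d1 r u t * potential_d2 r u t - potential r u t * potential_d3 r u t - 2 * potential r u t * potential_d1 r u t.

(** The integrand is [(phi'' + phi)^2 + (2 al be)^2 phi^2 >= 0], with [phi = psi - potential], up to the derivative
    of [boundary_term]. *)
Lemma completed_square r u psi psi1 psi2 a b : 0 <= r -> cont u -> supported r u ->
  (forall t, is_derive psi t (psi1 t)) -> (forall t, is_derive psi1 t (psi2 t)) -> cont psi2 ->
  a <= b ->
  boundary_term r u psi psi1 a - boundary_term r u psi psi1 b <=
  integral (fun t => psi2 t ^ 2 - 2 * psi1 t ^ 2 + (al ^ 2 + be ^ 2) ^ 2 * psi t ^ 2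
     - 2 * psi t * u t + potential r u t * u t) a b.
Proof.
  intros Hr Hu Su H0 H1 c2 Hab.
  assert (cpsi := cont_derive _ _ H0). assert (cpsi1 := cont_derive _ _ H1).
  assert (cV := cont_potential r u Hr Hu Su). assert (cV1 := cont_potential_d1 r u Hu). assert (cV2 := cont_potential_d2 r u Hu).
  assert (D0 := fun t => potential_derive r u t Hr Hu Su).
  assert (D1 := fun t => potential_d1_derive r u t Hu).
  assert (D2 := fun t => potential_d2_derive r u t Hu).
  assert (D3 := fun t => potential_d3_derive r u t Hr Hu Su).
  set (sq := fun t => ((psi2 t - potential_d2 r u t) + (psi t - potential r u t)) ^ 2 + (2 * al * be) ^ 2 * (psi t - potential r u t) ^ 2).
  set (e := fun t => psi2 t ^ 2 - 2 * psi1 t ^ 2 + (al ^ 2 + be ^ 2) ^ 2 * psi t ^ 2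
     - 2 * psi t * u t + potential r u t * u t).
  assert (csq : cont sq) by (unfold sq; cont_tac).
  assert (ce : cont e) by (unfold e; cont_tac).
  assert (HF : forall t, is_derive (boundary_term r u psi psi1) t (sq t - e t)).
  { intro t. specialize (D0 t); specialize (D1 t); specialize (D2 t); specialize (D3 t).
    specialize (H0 t); specialize (H1 t). unfold boundary_term. auto_derive.
    - repeat split; eexists; eauto.
    - derive_subst D0; derive_subst D1; derive_subst D2; derive_subst D3.
      derive_subst H0; derive_subst H1. eq_in_R. unfold sq, e.
      replace ((al ^ 2 + be ^ 2) ^ 2) with ((be ^ 2 - al ^ 2) ^ 2 + (2 * al * be) ^ 2) by ring.
      replace (be ^ 2 - al ^ 2) with 1 by (rewrite be_al; ring). ring. }
  assert (I := int_derive _ _ a b HF ltac:(cont_tac)).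
  rewrite int_minus in I by auto.
  assert (0 <= integral sq a b).
  { apply int_ge_0; auto. intros t _. unfold sq. apply Rplus_le_le_0_compat; [apply pow2_ge_0|].
    apply Rmult_le_pos; apply pow2_ge_0. }
  change (boundary_term r u psi psi1 a - boundary_term r u psi psi1 b <= integral e a b). lra.
Qed.

(** The value of [boundary_term] at a zero of [psi] where [psi' = d]. It depends on [psi] only
    through [d], so the contributions of adjacent half-waves cancel at their common end. *)
Definition node_term (r : R) (u : R -> R) (d z : R) : R :=
  - 2 * d * potential r u z - 2 * d * potential_d2 r u z + potential_d1 r u z * potential_d2 r u z - potential r u z * potential_d3 r u z.

Lemma piece_inequality r u p x c s : 0 < p -> 0 < x -> s ^ 2 = 1 ->
  0 <= r -> cont u -> supported r u ->
  node_term r u s (c - x) - node_term r u (- s) (c + x) <=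
  Nfun p x - 2 * Mfun p x + (al ^ 2 + be ^ 2) ^ 2 * Gfun p x
  - 2 * s * integral (fun t => profile p x (t - c) * u t) (c - x) (c + x)
  + integral (fun t => potential r u t * u t) (c - x) (c + x).
Proof.
  intros Hp Hx Hs Hr Hu Su.
  assert (P0 : forall t, is_derive (fun t => s * profile p x (t - c)) t (s * profile1 p x (t - c))).
  { intro t. assert (D := profile_derive p x Hp (t - c)). auto_derive.
    - eexists; exact D.
    - unfold Rminus in *. derive_subst D. eq_in_R. ring. }
  assert (P1 : forall t, is_derive (fun t => s * profile1 p x (t - c)) t (s * profile2 p x (t - c))).
  { intro t. assert (D := profile1_derive p x Hp (t - c)). auto_derive.
    - eexists; exact D.
    - unfold Rminus in *. derive_subst D. eq_in_R. ring. }
  assert (c0 := cont_profile p x Hp). assert (c1 := cont_profile1 p x Hp).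
  assert (c2 := cont_profile2 p x Hp).
  assert (cV := cont_potential r u Hr Hu Su).
  assert (Q := completed_square r u _ _ _ (c - x) (c + x) Hr Hu Su P0 P1 ltac:(cont_tac) ltac:(lra)).
  unfold boundary_term in Q.
  replace (c - x - c) with (- x) in Q by ring. replace (c + x - c) with x in Q by ring.
  rewrite profile_left, profile_right, profile1_left, profile1_right in Q by auto.
  rewrite (int_ext _ (fun t => 1 * (profile2 p x (t + - c) ^ 2) + (-2) * (profile1 p x (t + - c) ^ 2)
     + (al ^ 2 + be ^ 2) ^ 2 * (profile p x (t + - c) ^ 2)
     + (- 2 * s) * (profile p x (t - c) * u t) + potential r u t * u t)) in Q.
  2:{ intros t _. fold (t - c). rewrite !Rpow_mult_distr, Hs. ring. }
  rewrite !int_plus, !int_scal in Q by cont_tac.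
  rewrite (int_shift (fun t => profile2 p x t ^ 2)), (int_shift (fun t => profile1 p x t ^ 2)),
    (int_shift (fun t => profile p x t ^ 2)) in Q by cont_tac.
  replace (c - x + - c) with (- x) in Q by ring. replace (c + x + - c) with x in Q by ring.
  rewrite profile_G, profile_M, profile_N in Q by auto.
  unfold node_term. lra.
Qed.

Variables gam p1 x1 p2 x2 : R.
Hypothesis gam_pos : 0 < gam.
Hypothesis p1_pos : 0 < p1.
Hypothesis x1_pos : 0 < x1.
Hypothesis p2_pos : 0 < p2.
Hypothesis x2_pos : 0 < x2.

Definition period : R := 2 * (x1 + x2).
(** The positive parts of the periodic test function over [n] periods. The negative half-waves lie between the bumps;
    they enter the energy estimate but not the source. *)
Fixpoint bumps (n : nat) (t : R) : R :=
  match n with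
  | O => 0
  | S n => bumps n t + Rmax 0 (profile p2 x2 (t - INR n * period))
  end.

Lemma cont_bumps n : cont (bumps n).
Proof.
  assert (h := cont_profile p2 x2 p2_pos).
  induction n as [|n IH]; simpl; cont_tac.
Qed.

Lemma bumps_pos n t : 0 <= bumps n t.
Proof.
  induction n as [|n IH]; simpl; [lra|]. assert (h := Rmax_l 0 (profile p2 x2 (t - INR n * period))). lra.
Qed.

Lemma bumps_zero n t : (forall i, (i < n)%nat -> x2 <= Rabs (t - INR i * period)) -> bumps n t = 0.
Proof.
  induction n as [|n IH]; intros H; simpl; auto.
  rewrite IH by (intros; apply H; lia).
  rewrite Rmax_left; [ring|]. apply profile_sign_out; auto.
Qed.

Lemma bumps_on_bump n t j : (j < n)%nat -> Rabs (t - INR j * period) <= x2 ->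
  bumps n t = profile p2 x2 (t - INR j * period).
Proof.
  intros Hj Ht. induction n as [|n IH]; [lia|]. simpl.
  assert (far : forall i, i <> j -> x2 <= Rabs (t - INR i * period)).
  { intros i Hi. apply Rabs_le_between in Ht. unfold period in *.
    destruct (Nat.lt_ge_cases i j) as [L|L].
    - assert (INR (S i) <= INR j) by (apply le_INR; lia). rewrite S_INR in H.
      rewrite Rabs_pos_eq; nra.
    - assert (INR (S j) <= INR i) by (apply le_INR; lia). rewrite S_INR in H.
      rewrite Rabs_left1; nra. }
  destruct (Nat.eq_dec j n) as [->|Hne].
  - rewrite bumps_zero by (intros; apply far; lia).
    rewrite Rmax_right; [ring|]. apply profile_sign_in; auto.
  - rewrite IH by lia. rewrite Rmax_left; [ring|]. apply profile_sign_out; auto.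
Qed.

Lemma bumps_bound n t : Rabs (bumps n t) <= profile_height p2 x2.
Proof.
  rewrite Rabs_pos_eq by apply bumps_pos.
  destruct (Classical_Prop.classic (exists j, (j < n)%nat /\ Rabs (t - INR j * period) <= x2)) as [[j [Hj H]]|N].
  - rewrite (bumps_on_bump n t j) by auto. now apply profile_le_height.
  - rewrite bumps_zero; [left; now apply profile_height_pos|].
    intros i Hi. left. apply Rnot_le_lt. intro; apply N; exists i; auto.
Qed.

Lemma supported_bumps n : supported (INR n * period + x2) (bumps n).
Proof.
  intros t Ht. apply bumps_zero. intros i Hi.
  assert (hL : 0 < period) by (unfold period; lra).
  assert (INR i <= INR n) by (apply le_INR; lia). assert (h := pos_INR i).
  assert (INR i * period <= INR n * period) by nra. assert (0 <= INR i * period) by nra.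
  unfold Rabs in *. repeat destruct Rcase_abs; lra.
Qed.

(** Each period contributes one positive and one negative half-wave by [piece_inequality], and the node terms
    telescope. *)
Lemma bumps_energy n r : INR n * period + x2 <= r ->
  let u := fun t => gam * bumps n t in
  forall j, (j <= n)%nat ->
  node_term r u 1 (- x2) - node_term r u 1 (INR j * period - x2) <=
  INR j * (Nfun p1 x1 - 2 * Mfun p1 x1 + (al ^ 2 + be ^ 2) ^ 2 * Gfun p1 x1
    + Nfun p2 x2 - 2 * Mfun p2 x2 + ((al ^ 2 + be ^ 2) ^ 2 - gam) * Gfun p2 x2)
  + integral (fun t => potential r u t * u t) (- x2) (INR j * period - x2)
  - integral (fun t => gam * bumps n t ^ 2) (- x2) (INR j * period - x2).
Proof.
  intros Hr u.
  assert (hL : 0 < period) by (unfold period; lra).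
  assert (hn := pos_INR n).
  assert (Hr0 : 0 <= r) by nra.
  assert (cb := cont_bumps n).
  assert (cu : cont u) by (unfold u; cont_tac).
  assert (su : supported r u).
  { intros t Ht. unfold u. rewrite supported_bumps by lra. ring. }
  assert (cV := cont_potential r u Hr0 cu su).
  assert (cprof := cont_profile p2 x2 p2_pos). assert (cprof1 := cont_profile p1 x1 p1_pos).
  induction j as [|j IH]; intros Hj.
  - simpl INR. replace (0 * period - x2) with (- x2) by ring.
    rewrite !int_zero; [lra| |]; intros t Ht; rewrite Rmin_left, Rmax_left in Ht; lra.
  - specialize (IH ltac:(lia)). rewrite S_INR.
    set (c := INR j * period) in *.
    assert (A := piece_inequality r u p2 x2 c 1 p2_pos x2_pos ltac:(ring) Hr0 cu su).
    assert (B := piece_inequality r u p1 x1 (c + x2 + x1) (-1) p1_pos x1_pos ltac:(ring) Hr0 cu su).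
    replace (c + x2 + x1 - x1) with (c + x2) in B by ring.
    replace (c + x2 + x1 + x1) with ((INR j + 1) * period - x2) in B by (unfold c, period; ring).
    replace (- -1) with 1 in B by ring.
    set (z := (INR j + 1) * period - x2) in *.
    assert (z1 : z = c + x2 + 2 * x1) by (unfold z, c, period; ring).
    rewrite <- (int_chasles (fun t => potential r u t * u t) (- x2) (c - x2) z),
      <- (int_chasles (fun t => potential r u t * u t) (c - x2) (c + x2) z) by cont_tac.
    rewrite <- (int_chasles (fun t => gam * bumps n t ^ 2) (- x2) (c - x2) z),
      <- (int_chasles (fun t => gam * bumps n t ^ 2) (c - x2) (c + x2) z) by cont_tac.
    assert (on : forall t, c - x2 <= t <= c + x2 -> bumps n t = profile p2 x2 (t - c)).
    { intros t Ht. apply bumps_on_bump; [lia|]. fold c. apply Rabs_le; lra. }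
    assert (off : forall t, c + x2 <= t <= z -> bumps n t = 0).
    { intros t Ht. apply bumps_zero. intros i Hi.
      destruct (Nat.le_gt_cases i j) as [L|L].
      - apply le_INR in L. assert (INR i * period <= c) by (unfold c; nra). rewrite Rabs_pos_eq; lra.
      - assert (INR (S j) <= INR i) by (apply le_INR; lia). rewrite S_INR in H.
        assert ((INR j + 1) * period <= INR i * period) by nra. unfold z in Ht. rewrite Rabs_left1; lra. }
    assert (I1 : integral (fun t => profile p2 x2 (t - c) * u t) (c - x2) (c + x2) = gam * Gfun p2 x2).
    { assert (Sh := int_shift (fun t => profile p2 x2 t ^ 2) (- c) (c - x2) (c + x2) ltac:(cont_tac)).
      replace (c - x2 + - c) with (- x2) in Sh by ring. replace (c + x2 + - c) with x2 in Sh by ring.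
      rewrite profile_G in Sh by auto. rewrite <- Sh, <- int_scal by cont_tac.
      apply int_ext; intros t Ht. rewrite Rmin_left, Rmax_right in Ht by lra.
      unfold u. rewrite on by lra. unfold Rminus. ring. }
    assert (I2 : integral (fun t => gam * bumps n t ^ 2) (c - x2) (c + x2) = gam * Gfun p2 x2).
    { rewrite <- I1. apply int_ext; intros t Ht. rewrite Rmin_left, Rmax_right in Ht by lra.
      unfold u. rewrite on by lra. ring. }
    assert (I3 : integral (fun t => profile p1 x1 (t - (c + x2 + x1)) * u t) (c + x2) z = 0).
    { apply int_zero; intros t Ht. rewrite Rmin_left, Rmax_right in Ht by lra. unfold u. rewrite off by lra. ring. }
    assert (I4 : integral (fun t => gam * bumps n t ^ 2) (c + x2) z = 0).
    { apply int_zero; intros t Ht. rewrite Rmin_left, Rmax_right in Ht by lra. rewrite off by lra. ring. }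
    rewrite I1 in A. rewrite I3 in B. rewrite I2, I4.
    replace (-1) with (- (1)) in * by ring. lra.
Qed.

(** The source is [gam] times the train of bumps. The negative energy per period is multiplied by the
    number of periods, whereas the node terms at the two ends stay bounded. *)
Lemma positive_energy :
  Nfun p1 x1 - 2 * Mfun p1 x1 + (al ^ 2 + be ^ 2) ^ 2 * Gfun p1 x1
    + Nfun p2 x2 - 2 * Mfun p2 x2 + ((al ^ 2 + be ^ 2) ^ 2 - gam) * Gfun p2 x2 < 0 ->
  exists r w, 0 < r /\ cont w /\ (forall x, 0 <= w x) /\ supported r w /\
    0 < gam * pairing r w w - integral (fun x => w x ^ 2) (- r) r.
Proof.
  set (dlt := Nfun p1 x1 - _ + _ + _ - _ + _). intros Hneg.
  assert (hh := profile_height_pos p2 x2 p2_pos x2_pos).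
  destruct (potential_sup_bounds (gam * profile_height p2 x2)) as [K [HK HB]]; [nra|].
  (* The two end terms are at most 4 K + 2 K^2 each. *)
  destruct (nfloor_ex ((8 * K + 4 * K ^ 2) / - dlt)) as [m [_ Hm]].
  { apply Rdiv_le_0_compat; [|lra]. assert (h := pow2_ge_0 K). lra. }
  set (n := S m).
  assert (Hn : 8 * K + 4 * K ^ 2 < INR n * - dlt).
  { unfold n. rewrite S_INR. replace (8 * K + 4 * K ^ 2) with ((8 * K + 4 * K ^ 2) / - dlt * - dlt) by (field; lra).
    apply Rmult_lt_compat_r; lra. }
  set (r := INR n * period + x2).
  assert (hL : 0 < period) by (unfold period; lra).
  assert (hn := pos_INR n).
  assert (Hr : 0 < r) by (unfold r; nra).
  exists r, (bumps n). split; auto. split; [apply cont_bumps|]. split; [apply bumps_pos|].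
  assert (sb := supported_bumps n). fold r in sb. split; auto.
  assert (cb := cont_bumps n).
  assert (E := bumps_energy n r ltac:(unfold r; lra) n (le_n n)). cbv zeta in E. fold dlt in E.
  set (u := fun t => gam * bumps n t) in *.
  assert (cu : cont u) by (unfold u; cont_tac).
  assert (su : supported r u) by (intros t Ht; unfold u; rewrite sb by auto; ring).
  assert (cV := cont_potential r u ltac:(lra) cu su).
  assert (Hu : forall y, Rabs (u y) <= gam * profile_height p2 x2).
  { intro y. unfold u. rewrite Rabs_mult, (Rabs_pos_eq gam) by lra.
    apply Rmult_le_compat_l; [lra|apply bumps_bound]. }
  assert (node : forall z, Rabs (node_term r u 1 z) <= 4 * K + 2 * K ^ 2).
  { intro z. destruct (HB r u z ltac:(lra) cu su Hu) as [B0 [B1 [B2 B3]]].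
    apply Rabs_le_between in B0, B1, B2, B3. unfold node_term. apply Rabs_le.
    split; nra. }
  assert (N1 := node (- x2)). assert (N2 := node (INR n * period - x2)).
  apply Rabs_le_between in N1, N2.
  assert (whole : forall F, cont F -> (forall t, bumps n t = 0 -> F t = 0) ->
     integral F (- x2) (INR n * period - x2) = integral F (- r) r).
  { intros F cF HF. assert (0 <= INR n * period) by nra.
    rewrite <- (int_chasles F (- r) (- x2) r), <- (int_chasles F (- x2) (INR n * period - x2) r) by auto.
    rewrite (int_zero F (- r) (- x2)), (int_zero F (INR n * period - x2) r); [ring| |].
    - intros t Ht. rewrite Rmin_left, Rmax_right in Ht by (unfold r; lra).
      apply HF, bumps_zero. intros i Hi.
      assert (INR (S i) <= INR n) by (apply le_INR; lia). rewrite S_INR in H0.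
      assert ((INR i + 1) * period <= INR n * period) by nra.
      unfold period in *. rewrite Rabs_pos_eq; lra.
    - intros t Ht. rewrite Rmin_left, Rmax_right in Ht by (unfold r; lra).
      apply HF, bumps_zero. intros i Hi. assert (h := pos_INR i). assert (0 <= INR i * period) by nra.
      rewrite Rabs_left1; lra. }
  rewrite !whole in E; [| cont_tac | intros t Ht; rewrite Ht; ring | cont_tac | intros t Ht; unfold u; rewrite Ht; ring].
  assert (EP : integral (fun t => potential r u t * u t) (- r) r = gam ^ 2 * pairing r (bumps n) (bumps n)).
  { assert (Q := pairing_quad r gam 0 (bumps n) (bumps n) ltac:(lra) cb cb sb sb).
    replace (fun y => gam * bumps n y + 0 * bumps n y) with u in Q by (apply boolp.funext; intro; unfold u; ring).
    transitivity (pairing r u u); [|lra].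
    apply int_ext; intros; ring. }
  rewrite EP, int_scal in E by cont_tac.
  apply (Rmult_lt_reg_l gam); auto. rewrite Rmult_0_r. lra.
Qed.

End TestFunction.

(** * Decay at infinity *)

Definition vanishing (f : R -> R) : Prop :=
  forall eps, 0 < eps -> exists M, forall x, M < Rabs x -> Rabs (f x) < eps.

Lemma exp_decay_vanishing f r K : 0 <= K ->
  (forall x, r <= Rabs x -> Rabs (f x) <= K * exp (- al * (Rabs x - r))) -> vanishing f.
Proof.
  intros HK H eps He.
  destruct (exp_small (eps / (K + 1))) as [D [HD HDe]]; [apply Rdiv_lt_0_compat; lra|].
  exists (r + D). intros x Hx. eapply Rle_lt_trans; [apply H; lra|].
  assert (exp (- al * (Rabs x - r)) < exp (- al * D)) by (apply exp_increasing; nra).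
  assert (p := exp_pos (- al * (Rabs x - r))).
  apply Rle_lt_trans with (K * (eps / (K + 1))); [apply Rmult_le_compat_l; lra|].
  apply Rmult_lt_reg_r with (K + 1); [lra|]. replace (K * (eps / (K + 1)) * (K + 1)) with (K * eps) by (field; lra). lra.
Qed.

Lemma potential_vanishing r w : 0 <= r -> cont w -> supported r w -> vanishing (potential r w).
Proof.
  intros Hr Hw Sw.
  apply (exp_decay_vanishing _ r (green_max * integral (fun y => Rabs (w y)) (- r) r)).
  - apply Rmult_le_pos; [left; apply green_max_pos|]. apply int_ge_0; [lra|cont_tac|]. intros; apply Rabs_pos.
  - intros x Hx. replace (green_max * integral (fun y => Rabs (w y)) (- r) r * exp (- al * (Rabs x - r)))
      with (green_max * exp (- al * (Rabs x - r)) * integral (fun y => Rabs (w y)) (- r) r) by ring.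
    apply potential_far; auto; [lra|]. intros y Hy _.
    assert (T := Rabs_triang (x - y) y). replace (x - y + y) with x in T by ring.
    assert (Rabs y <= r) by (apply Rabs_le; lra). lra.
Qed.

(** To the right of the support, [causal_sin] is a damped oscillation. *)
Lemma causal_sin_decay r w x : 0 <= r -> cont w -> supported r w -> r <= x ->
  Rabs (causal_sin r w x) <= exp (- al * (x - r)) * integral (fun y => Rabs (w y)) (- r) r.
Proof.
  intros Hr Hw Sw Hx. unfold causal_sin.
  rewrite <- (int_chasles _ (- r) r x) by cont_tac.
  rewrite (int_zero _ r x).
  2:{ intros y Hy. rewrite Rmin_left, Rmax_right in Hy by lra. rewrite Sw; [ring|]. rewrite Rabs_pos_eq; lra. }
  rewrite Rplus_0_r, <- int_scal by cont_tac.
  eapply Rle_trans; [apply int_abs; [lra|cont_tac]|].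
  apply int_le; [lra|cont_tac|cont_tac|]. intros y Hy.
  eapply Rle_trans; [apply damped_bound; [apply Rabs_sin_le|left; apply exp_pos]|].
  apply Rmult_le_compat_r; [apply Rabs_pos|].
  destruct (Req_dec y r) as [->|Hne]; [lra|]. left; apply exp_increasing; nra.
Qed.

Lemma causal_sin_before r w x : cont w -> supported r w -> x <= - r -> causal_sin r w x = 0.
Proof.
  intros Hw Sw Hx. apply int_zero. intros y Hy. rewrite Rmin_right, Rmax_left in Hy by lra.
  rewrite Sw; [ring|]. unfold Rabs; destruct Rcase_abs; lra.
Qed.

Lemma potential_d1_vanishing r w : 0 <= r -> cont w -> supported r w -> vanishing (potential_d1 r w).
Proof.
  intros Hr Hw Sw.
  assert (hk := green_scale_pos). assert (hn : 0 < green_scale * (al ^ 2 + be ^ 2)) by (apply Rmult_lt_0_compat; auto; nra).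
  assert (cm := cont_mirror _ Hw). assert (sm := supported_mirror _ _ Sw).
  apply (exp_decay_vanishing _ r (green_scale * (al ^ 2 + be ^ 2) * integral (fun y => Rabs (w y)) (- r) r)).
  - apply Rmult_le_pos; [lra|]. apply int_ge_0; [lra|cont_tac|]. intros; apply Rabs_pos.
  - intros x Hx. unfold potential_d1. rewrite Rabs_mult, (Rabs_pos_eq (green_scale * _)) by lra.
    rewrite (Rmult_assoc (green_scale * _)). apply Rmult_le_compat_l; [lra|]. rewrite (Rmult_comm (integral _ _ _)).
    unfold Rabs in Hx; destruct Rcase_abs as [Hx0|Hx0] in Hx.
    + rewrite (causal_sin_before r w x), Rminus_0_r, (Rabs_left x) by (auto; lra).
      rewrite <- (mirror_L1 r w Hw). apply causal_sin_decay; auto.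
    + rewrite (causal_sin_before r (mirror w) (- x)) by (auto; lra).
      rewrite Rminus_0_l, Rabs_Ropp, (Rabs_pos_eq x) by lra. apply causal_sin_decay; auto; lra.
Qed.

End Kernel.

Lemma vanishing_affine f k d : 0 < k -> vanishing f -> vanishing (fun x => f (k * (x - d))).
Proof.
  intros Hk Hf eps He. destruct (Hf eps He) as [M HM]. exists (M / k + Rabs d).
  intros x Hx. apply HM. rewrite Rabs_mult, (Rabs_pos_eq k) by lra.
  assert (T := Rabs_triang_inv x d).
  apply Rlt_le_trans with (k * (Rabs x - Rabs d)); [|apply Rmult_le_compat_l; lra].
  replace M with (k * (M / k)) by (field; lra). apply Rmult_lt_compat_l; lra.
Qed.

Lemma vanishing_lim f g l m : vanishing f -> (forall x, g x = l + m * f x) ->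
  is_lim g p_infty l /\ is_lim g m_infty l.
Proof.
  intros Hf E.
  assert (H : forall eps : posreal, exists M, forall x, M < Rabs x -> Rabs (g x - l) < eps).
  { intro eps. assert (hm := Rabs_pos m).
    destruct (Hf (eps / (Rabs m + 1))) as [M HM].
    - apply Rdiv_lt_0_compat; [apply cond_pos|lra].
    - exists M. intros x Hx. specialize (HM x Hx). rewrite E.
      replace (l + m * f x - l) with (m * f x) by ring. rewrite Rabs_mult.
      apply Rle_lt_trans with ((Rabs m + 1) * Rabs (f x)).
      + apply Rmult_le_compat_r; [apply Rabs_pos|lra].
      + replace (pos eps) with ((Rabs m + 1) * (eps / (Rabs m + 1))) by (field; lra).
        apply Rmult_lt_compat_l; lra. }
  split; apply is_lim_spec; intro eps; destruct (H eps) as [M HM].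
  - exists (Rmax 0 M). intros x Hx. apply HM.
    assert (a := Rmax_l 0 M). assert (b := Rmax_r 0 M). rewrite Rabs_pos_eq; lra.
  - exists (- Rmax 0 M). intros x Hx. apply HM.
    assert (a := Rmax_l 0 M). assert (b := Rmax_r 0 M). rewrite Rabs_left; lra.
Qed.

Lemma vanishing_lin_eps k eps : 0 < eps ->
  exists e, 0 < e /\ forall z, Rabs z < e -> Rabs (k * z) < eps.
Proof.
  intros He. assert (hk := Rabs_pos k). exists (eps / (Rabs k + 1)).
  split; [apply Rdiv_lt_0_compat; lra|]. intros z Hz. rewrite Rabs_mult.
  apply Rle_lt_trans with ((Rabs k + 1) * Rabs z).
  - apply Rmult_le_compat_r; [apply Rabs_pos|lra].
  - replace eps with ((Rabs k + 1) * (eps / (Rabs k + 1))) by (field; lra).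
    apply Rmult_lt_compat_l; lra.
Qed.

(** * Travelling waves *)

Section Wave.
Variable c : R.
Variable y : nat -> R -> R.
Hypothesis y_derive : forall k s, (k < 4)%nat -> is_derive (y k) s (y (S k) s).
Hypothesis y_cont : forall k, (k <= 4)%nat -> cont (y k).
Definition wave (x t : R) : R := y 0 (x - c * t).

Lemma wave_derive_x k x t : (k <= 4)%nat -> Derive_n (fun x' => wave x' t) k x = y k (x - c * t).
Proof.
  revert x; induction k as [|k IH]; intros x Hk; simpl; auto.
  rewrite (Derive_ext _ (fun x' => y k (x' - c * t))) by (intros; apply IH; lia).
  apply is_derive_unique. assert (D := y_derive k (x - c * t) ltac:(lia)).
  auto_derive; [eexists; exact D|]. unfold Rminus in D |- *. derive_subst D. ring.
Qed.

Lemma wave_derive_t k x t : (k <= 4)%nat -> Derive_n (fun t' => wave x t') k t = (- c) ^ k * y k (x - c * t).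
Proof.
  revert t; induction k as [|k IH]; intros t Hk.
  - simpl. unfold wave. ring.
  - change (Derive (Derive_n (fun t' => wave x t') k) t = (- c) ^ S k * y (S k) (x - c * t)).
    rewrite (Derive_ext _ (fun t' => (- c) ^ k * y k (x - c * t'))) by (intros; apply IH; lia).
    apply is_derive_unique. assert (D := y_derive k (x - c * t) ltac:(lia)).
    auto_derive; [eexists; exact D|]. unfold Rminus in D |- *. derive_subst D. simpl. ring.
Qed.

Lemma wave_ex_derive_x k x t : (k <= 4)%nat -> ex_derive_n (fun x' => wave x' t) k x.
Proof.
  destruct k as [|k]; intros Hk; simpl; auto.
  apply (ex_derive_ext (fun x' => y k (x' - c * t))).
  - intros; symmetry; apply wave_derive_x; lia.
  - assert (D := y_derive k (x - c * t) ltac:(lia)). auto_derive. eexists; exact D.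
Qed.

Lemma wave_ex_derive_t k x t : (k <= 4)%nat -> ex_derive_n (fun t' => wave x t') k t.
Proof.
  destruct k as [|k]; intros Hk; simpl; auto.
  apply (ex_derive_ext (fun t' => (- c) ^ k * y k (x - c * t'))).
  - intros; symmetry; apply wave_derive_t; lia.
  - assert (D := y_derive k (x - c * t) ltac:(lia)). auto_derive. eexists; exact D.
Qed.

Lemma wave_cont k m x t : (k <= 4)%nat -> continuity_2d_pt (fun x0 t0 => m * y k (x0 - c * t0)) x t.
Proof.
  intros Hk. apply continuity_2d_pt_mult; [apply continuity_2d_pt_const|].
  apply (continuity_1d_2d_pt_comp (y k) (fun x0 t0 => x0 - c * t0)).
  - apply continuity_pt_filterlim, y_cont; auto.
  - apply continuity_2d_pt_minus; [apply continuity_2d_pt_id1|].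
    apply continuity_2d_pt_mult; [apply continuity_2d_pt_const|apply continuity_2d_pt_id2].
Qed.

Lemma wave_regular : classical_regularity wave.
Proof.
  intros x t _. split; intros k Hk; split.
  - now apply wave_ex_derive_x.
  - apply (continuity_2d_pt_ext (fun x0 t0 => 1 * y k (x0 - c * t0))); [|now apply wave_cont].
    intros; rewrite wave_derive_x by auto; ring.
  - apply wave_ex_derive_t; lia.
  - apply (continuity_2d_pt_ext (fun x0 t0 => (- c) ^ k * y k (x0 - c * t0))); [|apply wave_cont; lia].
    intros; rewrite wave_derive_t by lia; ring.
Qed.

End Wave.

(** By Cramer's rule the two values of [Rfun] solve [X G1 + Y G2 = 2 M1 + 2 M2 - N1 - N2]. The common
    denominator is nonzero, since otherwise the division by zero would give [A = 0]. *)
Lemma R_gives_negative_energy p1 p2 x1 x2 A B : 0 < p2 -> 0 < x2 -> 0 < A -> A = Rfun p1 p2 x1 x2 -> B < Rfun p2 p1 x2 x1 ->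
  Nfun p1 x1 - 2 * Mfun p1 x1 + A * Gfun p1 x1 + Nfun p2 x2 - 2 * Mfun p2 x2 + B * Gfun p2 x2 < 0.
Proof.
  intros Hp2 Hx2 HA EA HB.
  assert (HG := Gfun_pos p2 x2 Hp2 Hx2).
  assert (E : Rfun p1 p2 x1 x2 * Gfun p1 x1 + Rfun p2 p1 x2 x1 * Gfun p2 x2
    = 2 * Mfun p1 x1 + 2 * Mfun p2 x2 - Nfun p1 x1 - Nfun p2 x2).
  { rewrite EA in HA. unfold Rfun in *.
    set (d := Gfun p1 x1 * Gx p2 x2 + Gx p1 x1 * Gfun p2 x2) in *.
    replace (Gfun p2 x2 * Gx p1 x1 + Gx p2 x2 * Gfun p1 x1) with d by (unfold d; ring).
    assert (Hd : d <> 0).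
    { intro Hd. rewrite Hd in HA. unfold Rdiv in HA. rewrite Rinv_0 in HA. lra. }
    unfold d in *. field. exact Hd. }
  rewrite <- EA in E.
  assert (B * Gfun p2 x2 < Rfun p2 p1 x2 x1 * Gfun p2 x2) by (apply Rmult_lt_compat_r; auto). lra.
Qed.

(** The profile is the potential of the localized solution, divided by the multiplier so that the threshold becomes
    one. The functions [v k] are its derivatives. *)
Lemma normalised_wave_profile p1 p2 x1 x2 A B : 0 < p1 -> 0 < p2 -> 0 < x1 -> 0 < x2 -> 1 < A ->
  A = Rfun p1 p2 x1 x2 -> B < Rfun p2 p1 x2 x1 ->
  exists v : nat -> R -> R,
    (forall k s, (k < 4)%nat -> is_derive (v k) s (v (S k) s)) /\
    (forall k, (k <= 4)%nat -> cont (v k)) /\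
    (forall s, v 4%nat s + 2 * v 2%nat s + A * v 0%nat s = (A - B) * Rmax 0 (v 0%nat s - 1)) /\
    vanishing (v 0%nat) /\ vanishing (v 1%nat) /\ exists s, v 0%nat s <> 0.
Proof.
  intros Hp1 Hp2 Hx1 Hx2 HA EA HB.
  assert (HR := R_gives_negative_energy p1 p2 x1 x2 A B Hp2 Hx2 ltac:(lra) EA HB).
  assert (G1 := Gfun_pos p1 x1 Hp1 Hx1). assert (G2 := Gfun_pos p2 x2 Hp2 Hx2).
  assert (gam_pos : 0 < A - B).
  { apply Rnot_le_lt. intro N.
    assert (F1 := profile_form_nonneg p1 x1 Hp1 Hx1). assert (F2 := profile_form_nonneg p2 x2 Hp2 Hx2). nra. }
  (* These make (al^2 + be^2)^2 = (2 al^2 + 1)^2 equal to A. *)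
  set (al := sqrt ((sqrt A - 1) / 2)). set (be := sqrt (al ^ 2 + 1)).
  assert (hs : 1 < sqrt A) by (rewrite <- sqrt_1; apply sqrt_lt_1; lra).
  assert (al_pos : 0 < al) by (apply sqrt_lt_R0; lra).
  assert (al2 : al ^ 2 = (sqrt A - 1) / 2).
  { unfold al. simpl. rewrite Rmult_1_r, sqrt_sqrt; lra. }
  assert (be_pos : 0 < be) by (apply sqrt_lt_R0; nra).
  assert (be_al : be ^ 2 = al ^ 2 + 1).
  { unfold be. change (sqrt (al ^ 2 + 1) ^ 2) with (sqrt (al ^ 2 + 1) * (sqrt (al ^ 2 + 1) * 1)).
    rewrite Rmult_1_r, sqrt_sqrt; nra. }
  assert (EAA : (al ^ 2 + be ^ 2) ^ 2 = A).
  { rewrite be_al, al2. replace ((sqrt A - 1) / 2 + ((sqrt A - 1) / 2 + 1)) with (sqrt A) by field.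
    simpl. rewrite Rmult_1_r, sqrt_sqrt; lra. }
  destruct (positive_energy al be al_pos be_pos be_al (A - B) p1 x1 p2 x2 gam_pos Hp1 Hx1 Hp2 Hx2)
    as [r0 [w0 [Hr0 [cw [pw [sw en]]]]]].
  { rewrite EAA. replace (A - (A - B)) with B by ring. lra. }
  destruct (localized_solution al be al_pos be_pos be_al (A - B) r0 w0 gam_pos Hr0 cw pw sw en)
    as [r [mu [u [Hr [Hmu [cu [su [[s0 Hs0] Hu]]]]]]]].
  set (k := (A - B) / mu).
  set (v := fun j s => match j with
     | 0%nat => k * potential al be r u s | 1%nat => k * potential_d1 al be r u s | 2%nat => k * potential_d2 al be r u s
     | 3%nat => k * potential_d3 al be r u s
     | _ => k * (u s - 2 * potential_d2 al be r u s - (al ^ 2 + be ^ 2) ^ 2 * potential al be r u s) end).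
  assert (scalD : forall f d s, is_derive f s d -> is_derive (fun s => k * f s) s (k * d)).
  { intros f d s H. apply (is_derive_scal f s k d H). }
  assert (cV := cont_potential al be r u ltac:(lra) cu su).
  assert (cV2 := cont_potential_d2 al be be_al r u cu).
  assert (D : forall j s, (j < 4)%nat -> is_derive (v j) s (v (S j) s)).
  { intros [|[|[|[|j]]]] s Hj; try lia; apply scalD.
    - apply potential_derive; auto; lra.
    - apply potential_d1_derive; auto.
    - apply potential_d2_derive; auto.
    - apply potential_d3_derive; auto; lra. }
  exists v. split; auto. split; [|split; [|split; [|split]]].
  - intros j Hj. destruct (Nat.eq_dec j 4) as [->|Hne].
    + unfold v. cont_tac.
    + apply (cont_derive _ (v (S j))). intro s; apply D; lia.
  - intro s. unfold v. rewrite EAA.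
    assert (E : u s = mu * Rmax 0 (k * potential al be r u s - 1)).
    { rewrite Hu at 1. unfold k.
      rewrite <- (Rmult_0_r mu) at 1.
      replace ((A - B) * potential al be r u s - mu) with (mu * ((A - B) / mu * potential al be r u s - 1)) by (field; lra).
      rewrite RmaxRmult; [reflexivity|lra]. }
    set (z := Rmax 0 _) in *. rewrite E. unfold k. field. lra.
  - intros eps He. destruct (vanishing_lin_eps k eps He) as [e [He1 He2]].
    destruct (potential_vanishing al be al_pos be_pos be_al r u ltac:(lra) cu su e He1) as [M HM].
    exists M; intros x Hx; apply He2, HM, Hx.
  - intros eps He. destruct (vanishing_lin_eps k eps He) as [e [He1 He2]].
    destruct (potential_d1_vanishing al be al_pos be_pos be_al r u ltac:(lra) cu su e He1) as [M HM].
    exists M; intros x Hx; apply He2, HM, Hx.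
  - exists s0. intro Z. rewrite Hu in Hs0. unfold v, k in Z.
    assert ((A - B) * potential al be r u s0 = 0).
    { replace ((A - B) * potential al be r u s0) with (mu * ((A - B) / mu * potential al be r u s0)) by (field; lra). rewrite Z; ring. }
    rewrite H, Rmax_left in Hs0; lra.
Qed.

(** The profile is brought back to the original scale: [a = A K^4], [b = B K^4], [c^2 = 2 K^2]. *)
Theorem theorem22 (T p1 p2 c : R) (hT : 0 < T) (hp1 : 0 < p1) (hp2 : 0 < p2)
  (hc : c <> 0) (a b : R)
  (hab : exists x1 : R, 0 < x1 < T / 2 /\
     c ^ 4 / 4 < a /\
     a = c ^ 4 / 4 * Rfun p1 p2 x1 (T / 2 - x1) /\
     0 < b < c ^ 4 / 4 * Rfun p2 p1 (T / 2 - x1) x1) :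
  exists u : R -> R -> R, travelling_wave_solution a b c u.
Proof.
  destruct hab as [x1 [Hx1 [Ha [Ea [Hb0 Hb]]]]].
  assert (hc4 : 0 < c ^ 4 / 4).
  { assert (0 < c ^ 2) by (apply pow2_gt_0; auto). replace (c ^ 4) with (c ^ 2 * c ^ 2) by ring. nra. }
  set (K := sqrt (c ^ 2 / 2)).
  assert (hc2 : 0 < c ^ 2) by (apply pow2_gt_0; auto).
  assert (HK : 0 < K) by (apply sqrt_lt_R0; lra).
  assert (K2 : c ^ 2 = 2 * K ^ 2).
  { unfold K. rewrite pow2_sqrt; lra. }
  assert (K4 : c ^ 4 / 4 = K ^ 4).
  { replace (c ^ 4) with (c ^ 2 * c ^ 2) by ring. rewrite K2. field. }
  rewrite K4 in *.
  destruct (normalised_wave_profile p1 p2 x1 (T / 2 - x1) (a / K ^ 4) (b / K ^ 4)) as [v [Dv [Cv [Ev [L0 [L1 [s0 Hs0]]]]]]];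
    auto; try lra.
  { apply (Rmult_lt_reg_r (K ^ 4)); auto. replace (a / K ^ 4 * K ^ 4) with a by (field; lra). lra. }
  { rewrite Ea at 1. field. lra. }
  { apply (Rmult_lt_reg_l (K ^ 4)); auto. replace (K ^ 4 * (b / K ^ 4)) with b by (field; lra). lra. }
  assert (Ha0 : 0 < a) by lra.
  set (y := fun (k : nat) s => match k with 0%nat => (1 - v 0%nat (K * s)) / a | _ => - (K ^ k / a) * v k (K * s) end).
  assert (Dy : forall k s, (k < 4)%nat -> is_derive (y k) s (y (S k) s)).
  { intros k s Hk. assert (D := Dv k (K * s) Hk). destruct k as [|k]; unfold y.
    - auto_derive; [eexists; exact D|]. derive_subst D. eq_in_R. simpl. field. lra.
    - auto_derive; [eexists; exact D|]. derive_subst D. eq_in_R. simpl. field. lra. }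
  assert (Cy : forall k, (k <= 4)%nat -> cont (y k)).
  { intros k Hk. assert (C := Cv k Hk). destruct k as [|k]; unfold y; cont_tac. }
  exists (wave c y). split.
  - split; [|split].
    + now apply wave_regular.
    + intros x t _. rewrite (wave_derive_x c y Dy 4), (wave_derive_t c y Dy 2) by lia.
      unfold wave. set (s := x - c * t). specialize (Ev (K * s)). unfold y.
      unfold pos_part, neg_part.
      set (v0 := v 0%nat (K * s)) in *. set (v2 := v 2%nat (K * s)) in *. set (v4 := v 4%nat (K * s)) in *.
      assert (P : a * Rmax ((1 - v0) / a) 0 = Rmax (1 - v0) 0).
      { rewrite <- RmaxRmult, Rmult_0_r by lra. f_equal. field. lra. }
      assert (N : a * Rmax (- ((1 - v0) / a)) 0 = Rmax (v0 - 1) 0).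
      { rewrite <- RmaxRmult, Rmult_0_r by lra. f_equal. field. lra. }
      assert (N' : b * Rmax (- ((1 - v0) / a)) 0 = b / a * Rmax (v0 - 1) 0).
      { rewrite <- N. field. lra. }
      rewrite P, N'. rewrite (Rmax_comm 0 (v0 - 1)) in Ev.
      replace ((- c) ^ 2) with (c ^ 2) by ring. rewrite K2.
      assert (V4 : v4 = (a / K ^ 4 - b / K ^ 4) * Rmax (v0 - 1) 0 - 2 * v2 - a / K ^ 4 * v0) by lra.
      rewrite V4.
      assert (S : Rmax (1 - v0) 0 = 1 - v0 + Rmax (v0 - 1) 0).
      { unfold Rmax; repeat destruct Rle_dec; lra. }
      rewrite S. field. split; lra.
    + intros t _.
      assert (A0 := vanishing_affine _ K (c * t) HK L0). assert (A1 := vanishing_affine _ K (c * t) HK L1).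
      assert (B0 := vanishing_lim _ (fun x => wave c y x t) (1 / a) (- / a) A0).
      assert (B1 := vanishing_lim _ (fun x => Derive (fun x' => wave c y x' t) x) 0 (- (K ^ 1 / a)) A1).
      destruct B0 as [B0p B0m]. { intro x. unfold wave, y. field. lra. }
      destruct B1 as [B1p B1m]. { intro x.
        change (Derive_n (fun x' => wave c y x' t) 1 x = 0 + - (K ^ 1 / a) * v 1%nat (K * (x - c * t))).
        rewrite (wave_derive_x c y Dy 1 x t) by lia. unfold y. ring. }
      auto.
  - exists (y 0%nat). split; [reflexivity|]. exists (s0 / K). unfold y.
    replace (K * (s0 / K)) with s0 by (field; lra). intro E.
    apply Hs0. apply (Rmult_eq_compat_r a) in E.
    replace ((1 - v 0%nat s0) / a * a) with (1 - v 0%nat s0) in E by (field; lra).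
    replace (1 / a * a) with 1 in E by (field; lra). lra.
Qed.
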